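(* Let $\Delta$ be a thick building, let $\Sigma$ be an apartment of $\Delta$, and let $\kappa$ be a convex chamber subcomplex of $\Sigma$. Then there exists an apartment $\Sigma'$ of $\Delta$ such that $\kappa=\Sigma\cap\Sigma'$.
   Context: Buildings are finite-dimensional simplicial complexes (chamber complexes admitting a system of apartments satisfying Tits' axioms), of arbitrary type. Chambers are the maximal simplices, panels the simplices of codimension 1; $\Delta$ is thick if each panel is contained in at least three chambers. ''Apartment of $\Delta$'' means a member of the complete (maximal) system of apartments; if $\Delta$ is of type $(W,S)$ these are exactly the simplicial subcomplexes of $\Delta$ isomorphic to the standard Coxeter complex $\Sigma(W,S)$. Two chambers are adjacent if they are different and share a panel; a gallery of length $n$ is a sequence $(C_0,\dots,C_n)$ of chambers with $C_{i-1},C_i$ adjacent for all $i$; $\mathrm{d}(C,D)$ is the minimal length of a gallery from $C$ to $D$. A chamber subcomplex (one whose maximal simplices are chambers of $\Delta$; in particular it contains a chamber) is convex if it contains every gallery of length $\mathrm{d}(C,D)$ between any two of its chambers $C,D$. *)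

(* Defs.v *)
From HB Require Import structures.
From mathcomp Require Import all_boot finmap boolp classical_sets functions.

Set Implicit Arguments.
Unset Strict Implicit.
Unset Printing Implicit Defensive.

Local Open Scope classical_set_scope.

(* A simplicial complex is given by the set of its simplices, which are finite
   sets of vertices.  The empty simplex is a simplex of every complex, and an
   element v of V is a vertex of K when [fset v] belongs to K: V may contain
   more points than K has vertices. *)

Section Complexes.
Local Open Scope fset_scope.
Variable V : choiceType.
Implicit Types (K L : set {fset V}) (A B C D P : {fset V}).

Definition simplicial_complex K : Prop :=
  K fset0 /\ forall A B, K A -> B `<=` A -> K B.

Definition subcomplex L K : Prop :=
  simplicial_complex L /\ (L `<=` K)%classic.

Definition finite_dimensional K : Prop :=
  exists n : nat, forall A, K A -> #|` A| <= n.

Definition chamber K C : Prop :=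
  K C /\ forall D, K D -> C `<=` D -> D = C.

Definition panel K P : Prop :=
  exists C, [/\ chamber K C, P `<=` C & #|` C| = #|` P|.+1].

Definition thick K : Prop :=
  forall P, panel K P ->
    exists C1 C2 C3,
      [/\ chamber K C1, chamber K C2 & chamber K C3] /\
      [/\ P `<=` C1, P `<=` C2 & P `<=` C3] /\
      [/\ C1 <> C2, C1 <> C3 & C2 <> C3].

Definition adjacent K C D : Prop :=
  [/\ chamber K C, chamber K D, C <> D &
      exists P, [/\ panel K P, P `<=` C & P `<=` D]].

(* C :: s is a gallery from C to D; its length is size s. *)
Definition gallery K C D (s : seq {fset V}) : Prop :=
  [/\ chamber K C, path (fun E F => `[< adjacent K E F >]) C s & last C s = D].

(* The value is the junk value 0 when no gallery joins C to D. *)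
Definition dist K C D : nat :=
  xget 0 [set n : nat | (exists2 s, gallery K C D s & size s = n) /\
                        forall s, gallery K C D s -> n <= size s].

Definition chamber_complex K : Prop :=
  [/\ simplicial_complex K, finite_dimensional K,
      forall C D, chamber K C -> chamber K D -> #|` C| = #|` D| &
      forall C D, chamber K C -> chamber K D -> exists s, gallery K C D s].

Definition chamber_subcomplex L K : Prop :=
  subcomplex L K /\ forall C, chamber L C -> chamber K C.

Definition convex K L : Prop :=
  forall C D s, chamber K C -> chamber K D -> L C -> L D ->
    gallery K C D s -> size s = dist K C D ->
    forall E, E \in C :: s -> L E.

(* Since K contains the singletons of its vertices, f is then injective on the
   vertices of K, and its inverse is simplicial as well. *)
Definition simplicial_iso K L (f : V -> V) : Prop :=
  set_bij K L (fun A => [fset f v | v in A]).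

End Complexes.

Section Coxeter.
Local Open Scope group_scope.
Variable W : groupType.
Implicit Types (S J : {fset W}) (u v : seq W).

(* The congruence on words generated by the Coxeter relations
   (s t) ^ m(s, t) = 1, with m(s, t) the order of s * t in W.  Relators
   (s t) ^ n with n an arbitrary multiple of m(s, t) are allowed (only n = 0 when
   the order is infinite): they are consequences of the former.  Since m(s, s) = 1
   makes each generator its own inverse, this congruence on the free monoid
   presents the same group as the Coxeter presentation does. *)
Inductive coxeter_congr S : seq W -> seq W -> Prop :=
| coxeter_relator u v s t n : s \in S -> t \in S -> (s * t) ^+ n = 1 ->
    coxeter_congr S (u ++ flatten (nseq n [:: s; t]) ++ v) (u ++ v)
| coxeter_refl u : coxeter_congr S u u
| coxeter_sym u v : coxeter_congr S u v -> coxeter_congr S v u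
| coxeter_trans u v w :
    coxeter_congr S u v -> coxeter_congr S v w -> coxeter_congr S u w.

(* The submonoid generated by J; it is the subgroup generated by J when J
   consists of involutions. *)
Definition parabolic J : set W :=
  [set w : W | exists2 u : seq W, {subset u <= J} & w = \prod_(x <- u) x].

Definition coxeter_system S : Prop :=
  [/\ forall s, s \in S -> s <> 1 /\ s * s = 1,
      parabolic S = setT &
      forall u, {subset u <= S} -> \prod_(x <- u) x = 1 ->
        coxeter_congr S u [::]].

Definition standard_coset S : set (set W) :=
  [set X | exists w : W, exists2 J : {fset W}, (J `<=` S)%fset &
             X = [set w * x | x in parabolic J]].

End Coxeter.

Section Buildings.
Variable V : choiceType.
Implicit Types (Delta Sigma : set {fset V}) (AA : set (set {fset V})).

(* The simplices of the standard Coxeter complex Sigma(W, S) are the cosets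
   w W_J, ordered by reverse inclusion; complexes are isomorphic when their
   posets of simplices are. *)
Definition coxeter_complex Sigma : Prop :=
  exists (W : groupType) (S : {fset W}), coxeter_system S /\
    exists2 phi : {fset V} -> set W, set_bij Sigma (standard_coset S) phi &
      forall A B, Sigma A -> Sigma B ->
        (A `<=` B)%fset <-> (phi B `<=` phi A)%classic.

Definition apartment_system Delta AA : Prop :=
  [/\ forall Sigma, AA Sigma -> subcomplex Sigma Delta /\ coxeter_complex Sigma,
      forall A B, Delta A -> Delta B ->
        exists2 Sigma, AA Sigma & Sigma A /\ Sigma B &
      forall Sigma Sigma' A B, AA Sigma -> AA Sigma' ->
        Sigma A -> Sigma B -> Sigma' A -> Sigma' B ->
        exists2 f : V -> V, simplicial_iso Sigma Sigma' f &
          forall v, v \in (A `|` B)%fset -> f v = v].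

Definition building Delta : Prop :=
  chamber_complex Delta /\ exists AA, apartment_system Delta AA.

(* The union of all apartment systems of a building is again an apartment
   system, hence the largest one: this is the complete system of apartments. *)
Definition complete_system Delta : set (set {fset V}) :=
  [set Sigma | exists2 AA, apartment_system Delta AA & AA Sigma].

Definition apartment Delta Sigma : Prop := complete_system Delta Sigma.

Lemma complete_systemE Delta AA :
  apartment_system Delta AA ->
  (forall AA', apartment_system Delta AA' -> (AA' `<=` AA)%classic) ->
  complete_system Delta = AA.
Proof.
move=> AAs AAmax; apply/seteqP; split=> [Sigma [AA' AA's]|Sigma SAA].
  exact: AAmax.
by exists AA.
Qed.

End Buildings.

(* Main.v *)
(* Fix an apartment system containing Sigma, let (W, S) be the type of Sigma, and
   equip the chambers of Delta with their W-valued distance.  The isometric images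
   of W form an apartment system, and any isometry from a subset of W extends to W.

   Let c : W -> Sigma be the identity chart and X the convex set of the x with c x
   in kappa.  First extend the restriction of c to X to all w s outside X with w in
   X and s in S, always choosing a chamber outside Sigma.  If the chamber at w s is
   not forced by an earlier choice, thickness provides one; if it is forced by one
   at w' s', the two panels lie on a common wall, and a choice in Sigma at w s would
   put the one at w' s' in Sigma as well.  Then extend the result to an isometry b
   of W.  A minimal gallery of b from kappa to a chamber of Sigma stays in Sigma,
   so it never leaves kappa; hence Sigma and b have only the chambers of kappa in
   common.  A simplex A in both lies in such a chamber, because the chamber
   containing A nearest to a given chamber of kappa is the same in both. *)
Require Import Defs.
From mathcomp Require Import all_boot finmap boolp classical_sets functions zify.

Set Implicit Arguments.
Unset Strict Implicit.
Unset Printing Implicit Defensive.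

Local Open Scope group_scope.

(** * Coxeter groups *)

Section Words.
Variable W : groupType.
Implicit Types (S J K : {fset W}) (u v : seq W) (s t w x y z : W).

Definition prodw u : W := \prod_(x <- u) x.

Lemma prodw_cons s u : prodw (s :: u) = s * prodw u.
Proof. by rewrite /prodw big_cons. Qed.

Lemma prodw_nil : prodw [::] = 1.
Proof. by rewrite /prodw big_nil. Qed.

Lemma prodw_cat u v : prodw (u ++ v) = prodw u * prodw v.
Proof. by rewrite /prodw big_cat. Qed.

(* For a reduced word u, these are the reflections in the walls that separate 1
   from prodw u. *)
Fixpoint refl u : seq W :=
  if u is s :: v then s :: [seq s * r * s^-1 | r <- refl v] else [::].

Lemma size_refl u : size (refl u) = size u.
Proof. by elim: u => //= s u IH; rewrite size_map IH. Qed.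

Lemma refl_cat u v :
  refl (u ++ v) = refl u ++ [seq prodw u * r * (prodw u)^-1 | r <- refl v].
Proof.
elim: u => [|s u IH] /=.
  by rewrite prodw_nil -[LHS]map_id; apply: eq_map => r; rewrite invg1 mul1g mulg1.
rewrite IH map_cat -map_comp; congr (_ :: _ ++ _); apply: eq_map => r /=.
by rewrite prodw_cons invgM !mulgA.
Qed.

Lemma refl_relator s t n : s * s = 1 -> t * t = 1 ->
  refl (flatten (nseq n [:: s; t])) = [seq (s * t) ^+ i * s | i <- iota 0 n.*2].
Proof.
move=> ss tt; have sV : s^-1 = s by apply: mulg1_eq.
have tV : t^-1 = t by apply: mulg1_eq.
elim: n => [|n IH] //; rewrite doubleS /= IH /= expg0 mul1g expg1.
congr (_ :: _ :: _); first by rewrite sV.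
rewrite -map_comp (iotaDl 2 0) -!map_comp; apply: eq_map => i /=.
by rewrite tV sV !addSn add0n expgSr expgS !mulgA.
Qed.

(** A relator contributes the reflections [(s * t) ^+ i * s] for [i < 2n]. Since [(s * t) ^+ n = 1],
    the second half repeats the first, so each occurs an even number of times; as the relator has
    product 1, the reflections of what follows are unchanged. *)
Lemma odd_count_congr S u v x : (forall s, s \in S -> s * s = 1) ->
  coxeter_congr S u v -> odd (count_mem x (refl u)) = odd (count_mem x (refl v)).
Proof.
move=> inv; elim=> {u v} [u v s t n sS tS stn|//|//|u v w _ -> _ ->] //.
have prodR : prodw (flatten (nseq n [:: s; t])) = 1.
  rewrite -stn; elim: n {stn} => [|n IH] /=; first by rewrite prodw_nil expg0.
  by rewrite !prodw_cons IH expgS mulgA.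
rewrite !refl_cat !count_cat prodR !oddD; congr (_ (+) _).
rewrite map_cat count_cat oddD.
set a := odd _; suff -> : a = false.
  by rewrite addFb -map_comp; congr (odd (count_mem x _));
    apply: eq_map => r /=; rewrite invg1 mul1g mulg1.
rewrite {}/a refl_relator ?inv // -addnn iotaD add0n.
have -> : iota n n = map (addn n) (iota 0 n) by rewrite -iotaDl addn0.
rewrite !map_cat count_cat oddD -!map_comp; set a := odd _; set b := odd _.
suff -> : b = a by rewrite addbb.
congr (odd (count_mem x _)); apply: eq_map => i /=.
by rewrite expgnDr stn mul1g.
Qed.

Lemma refl_mem x u : x \in refl u ->
  exists p s q, u = p ++ s :: q /\ x = prodw p * s * (prodw p)^-1.
Proof.
elim: u x => //= s u IH x; rewrite inE => /orP[/eqP ->|/mapP[r /IH [p [t [q [-> ->]]]] ->]].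
  by exists [::], s, u; rewrite prodw_nil invg1 mul1g mulg1.
by exists (s :: p), t, q; rewrite prodw_cons invgM !mulgA.
Qed.

(** Deletion condition: if [s] recurs among the reflections of [s :: u], then [s = q b q^-1] for a
    splitting [q ++ b :: r] of [u], so [s q b r = q r]. *)
Lemma refl_dup u : {in u, forall s, s * s = 1} -> ~~ uniq (refl u) ->
  exists p a q b r, u = p ++ a :: q ++ b :: r /\ prodw u = prodw (p ++ q ++ r).
Proof.
elim: u => //= s u IH inv; rewrite negb_and negbK map_inj_uniq; last first.
  by move=> x y /mulIg /mulgI.
case/orP => [/mapP[x xu exs]|/IH [|p [a [q [b [r [-> E]]]]]]]; last first.
- by exists (s :: p), a, q, b, r; split => //; rewrite cat_cons !prodw_cons E.
- by move=> t tu; apply: inv; rewrite inE tu orbT.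
have xs : x = s.
  by move: exs => /(congr1 (fun z => z * s)); rewrite mulgVK => /mulgI.
subst x; have [q [b [r [eu sE]]]] := refl_mem xu; subst u.
exists [::], s, q, b, r; split => //=.
rewrite prodw_cons !prodw_cat prodw_cons {1}sE -!mulgA mulKg (mulgA b) inv ?mul1g //.
by rewrite inE mem_cat inE eqxx !orbT.
Qed.

Lemma cat_split (T : eqType) (a b c d : seq T) : a ++ b = c ++ d -> size c <= size a ->
  exists e, a = c ++ e /\ d = e ++ b.
Proof.
move=> E le; have ea : a = c ++ drop (size c) a.
  rewrite -[LHS](cat_take_drop (size c)); congr (_ ++ _).
  by have := congr1 (take (size c)) E; rewrite takel_cat // take_size_cat.
exists (drop (size c) a); split => //; move: E; rewrite {1}ea -catA => /eqP.
by rewrite eqseq_cat // eqxx /= => /eqP.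
Qed.

(** A reflection occurring exactly once for [u] occurs an odd number of times for [v], hence at
    least once. So words with distinct reflections are shortest. *)
Lemma refl_uniq_leq S u v : (forall s, s \in S -> s * s = 1) ->
  coxeter_congr S u v -> uniq (refl u) -> size u <= size v.
Proof.
move=> inv uv uu; rewrite -(size_refl u) -(size_refl v); apply: uniq_leq_size => // x xu.
have := odd_count_congr x inv uv; rewrite count_uniq_mem // xu.
by case: (count_mem x (refl v)) (@has_count _ (pred1 x) (refl v)) => // n; rewrite has_pred1.
Qed.

End Words.

(** * Word lengths in Coxeter groups and their parabolic subgroups *)

Section Coxeter.
Variables (W : groupType) (S : {fset W}).
Hypothesis cox : coxeter_system S.
Implicit Types (J K : {fset W}) (u v : seq W) (s t w x y z : W).

Lemma gen_sqr s : s \in S -> s * s = 1.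
Proof. by case: cox => H _ _ /H []. Qed.

Lemma gen_neq1 s : s \in S -> s <> 1.
Proof. by case: cox => H _ _ /H []. Qed.

Lemma gen_inv s : s \in S -> s^-1 = s.
Proof. by move=> /gen_sqr /mulg1_eq. Qed.

Lemma prodw_rev u : {subset u <= S} -> prodw (rev u) = (prodw u)^-1.
Proof.
elim: u => [|s u IH] uS; first by rewrite prodw_nil invg1.
rewrite rev_cons -cats1 prodw_cat !prodw_cons prodw_nil mulg1 invgM.
by rewrite (gen_inv (uS s (mem_head _ _))) IH // => t tu; apply: uS; rewrite inE tu orbT.
Qed.

Lemma congr_ctx a b u v : coxeter_congr S u v -> coxeter_congr S (a ++ u ++ b) (a ++ v ++ b).
Proof.
elim=> {u v} [u v s t n sS tS stn|u|u v _|u v w _ uv _] //.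
- rewrite -!catA !(catA a u).
  exact: coxeter_relator.
- exact: coxeter_refl.
- exact: coxeter_sym.
- exact: coxeter_trans.
Qed.

Lemma rev_congr u : {subset u <= S} -> coxeter_congr S (rev u ++ u) [::].
Proof.
elim: u => [|s u IH] uS; first exact: coxeter_refl.
have sS : s \in S by apply: uS; rewrite mem_head.
apply: coxeter_trans (IH _); last by move=> t tu; apply: uS; rewrite inE tu orbT.
rewrite rev_cons cat_rcons; have := @coxeter_relator _ S (rev u) u s s 1 sS sS.
by apply; rewrite expg1 gen_sqr.
Qed.

Lemma congr_of_prod u v : {subset u <= S} -> {subset v <= S} ->
  prodw u = prodw v -> coxeter_congr S u v.
Proof.
move=> uS vS uv; apply: (@coxeter_trans _ _ _ (u ++ rev v ++ v)).
  apply: coxeter_sym; have := congr_ctx u [::] (rev_congr vS).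
  by rewrite !cats0.
rewrite catA; apply: (congr_ctx [::] v (_ : coxeter_congr S (u ++ rev v) [::])).
case: cox => _ _; apply.
  by move=> s; rewrite mem_cat mem_rev => /orP[/uS|/vS].
by rewrite -/(prodw _) prodw_cat prodw_rev // uv mulgV.
Qed.

Lemma refl_uniq_min u v : {subset u <= S} -> {subset v <= S} ->
  prodw u = prodw v -> uniq (refl u) -> size u <= size v.
Proof. by move=> uS vS uv; apply: refl_uniq_leq (congr_of_prod uS vS uv) => s /gen_sqr. Qed.

Lemma odd_size u v : {subset u <= S} -> {subset v <= S} ->
  prodw u = prodw v -> odd (size u) = odd (size v).
Proof.
move=> uS vS uv; elim: (congr_of_prod uS vS uv) => {u v uS vS uv} //.
  move=> u v s t n _ _ _; rewrite !size_cat !oddD; congr (_ (+) _).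
  by rewrite size_flatten /shape map_nseq sumn_nseq /= oddM.
by move=> u v w _ -> _ ->.
Qed.

(* len J w is the least length of a J-word for w, and the junk value 0 when w
   is not in parabolic J. *)
Definition len J w : nat :=
  xget 0 [set n : nat | (exists u, [/\ {subset u <= J}, prodw u = w & size u = n]) /\
     forall u, {subset u <= J} -> prodw u = w -> n <= size u]%classic.

Lemma len_word J w : parabolic J w ->
  exists u, [/\ {subset u <= J}, prodw u = w & size u = len J w].
Proof.
move=> [u0 u0J eu0].
pose P n := `[< exists u, [/\ {subset u <= J}, prodw u = w & size u = n] >].
have exP : exists n, P n by exists (size u0); apply/asboolP; exists u0.
case: (ex_minnP exP) => m /asboolP mP mmin; rewrite /len.
set A := [set _ | _]%classic.
have : A (xget 0 A).
  apply: xgetPex; exists m; split => // u uJ uw; apply: mmin; apply/asboolP.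
  by exists u.
by case.
Qed.

Lemma len_leq J u : {subset u <= J} -> len J (prodw u) <= size u.
Proof.
move=> uJ; rewrite /len; set A := [set _ | _]%classic.
case: (xgetP 0 A) => [n _ [_]|//]; exact.
Qed.

Lemma parabolicT w : parabolic S w.
Proof. by case: cox => _ -> _. Qed.

Lemma parabolic_word J u : {subset u <= J} -> parabolic J (prodw u).
Proof. by exists u. Qed.

Lemma parabolic1 J : parabolic J 1.
Proof. by exists [::]; rewrite // big_nil. Qed.

Lemma parabolicM J w z : parabolic J w -> parabolic J z -> parabolic J (w * z).
Proof.
move=> [u uJ ->] [v vJ ->]; exists (u ++ v); last exact/esym/prodw_cat.
by move=> s; rewrite mem_cat => /orP[/uJ|/vJ].
Qed.

Lemma parabolic_gen J s : s \in J -> parabolic J s.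
Proof.
move=> sJ; exists [:: s]; last exact/esym/big_seq1.
by move=> t; rewrite inE => /eqP ->.
Qed.

Lemma parabolicV J w : (J `<=` S)%fset -> parabolic J w -> parabolic J w^-1.
Proof.
move=> /fsubsetP JS [u uJ ->]; exists (rev u); first by move=> s; rewrite mem_rev => /uJ.
by rewrite -/(prodw _) -/(prodw _) prodw_rev // => s /uJ /JS.
Qed.

Lemma parabolicS J K w : (J `<=` K)%fset -> parabolic J w -> parabolic K w.
Proof. by move=> /fsubsetP JK [u uJ ->]; exists u => // s /uJ /JK. Qed.

Lemma parabolic0 w : parabolic fset0 w -> w = 1.
Proof.
move=> [[|s u] uJ ->]; first exact: big_nil.
by have := uJ s (mem_head _ _); rewrite inE.
Qed.

Lemma parabolic_sing s w : s \in S -> parabolic [fset s]%fset w -> w = 1 \/ w = s.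
Proof.
move=> sS [u + ->]; rewrite -/(prodw u); elim: u => [|t u IH] uJ; first by left; rewrite prodw_nil.
rewrite prodw_cons; have := uJ t (mem_head _ _); rewrite inE => /eqP ->.
have [|->|->] := IH; last by left; rewrite gen_sqr.
  by move=> x xu; apply: uJ; rewrite inE xu orbT.
by right; rewrite mulg1.
Qed.

Lemma len_word_uniq J u : (J `<=` S)%fset -> {subset u <= J} -> size u = len J (prodw u) ->
  uniq (refl u).
Proof.
move=> /fsubsetP JS uJ su; apply/negPn/negP => /refl_dup[|p [a [q [b [r [E P]]]]]].
  by move=> s /uJ /JS /gen_sqr.
suff : len J (prodw u) <= size (p ++ q ++ r).
  by rewrite -su E !size_cat /= size_cat /= !addnS; lia.
rewrite P; apply: len_leq => s sin; apply: uJ; rewrite E; move: sin.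
by rewrite !(mem_cat, inE) => /or3P[] ->; rewrite ?orbT.
Qed.

(** A shortest [J]-word for [s] has distinct reflections, hence is no longer than [[:: s]]. *)
Lemma parabolic_mem J s : (J `<=` S)%fset -> s \in S -> parabolic J s -> s \in J.
Proof.
move=> JS sS Js; have [u [uJ us su]] := len_word Js.
have uu : uniq (refl u) by apply: (len_word_uniq JS uJ); rewrite us.
have := refl_uniq_min (v := [:: s]) _ _ _ uu.
move=> le1; have {le1} : size u <= size [:: s].
  apply: le1 => [x /uJ|x|]; [exact: (fsubsetP JS)| by rewrite inE => /eqP ->|].
  by rewrite us prodw_cons prodw_nil mulg1.
case: u uJ us {su uu} => [|t [|//]] uJ us _; first by case: (gen_neq1 sS); rewrite -us prodw_nil.
by rewrite -us prodw_cons prodw_nil mulg1 uJ ?mem_head.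
Qed.

(** A shortest word of [d] followed by a shortest [J]-word of [w] is reduced: otherwise two letters
    can be deleted, and wherever they stand this contradicts the minimality of a factor. *)
Lemma len_mul_min J d w : (J `<=` S)%fset -> parabolic J w ->
  (forall z, parabolic J z -> len S d <= len S (d * z)) ->
  len S (d * w) = len S d + len J w.
Proof.
move=> JS Jw dmin; have [a [aS ad sa]] := len_word (parabolicT d).
have [b [bJ bw sb]] := len_word Jw; have JS' := fsubsetP JS.
have abS : {subset a ++ b <= S} by move=> s; rewrite mem_cat => /orP[/aS|/bJ /JS'].
have E : prodw (a ++ b) = d * w by rewrite prodw_cat ad bw.
suff U : uniq (refl (a ++ b)).
  have [v [vS vdw sv]] := len_word (parabolicT (d * w)).
  apply/eqP; rewrite eqn_leq -sa -sb -size_cat -{1}E len_leq //= -sv.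
  by apply: refl_uniq_min => //; rewrite E vdw.
apply/negPn/negP => /refl_dup[s /abS /gen_sqr //|p [x [q [y [r [eab P]]]]]].
have lena v : {subset v <= S} -> parabolic J (d^-1 * prodw v) -> size a <= size v.
  move=> vS /dmin; rewrite mulVKg sa => /leq_trans; apply; exact: len_leq.
have [sap|sap] := leqP (size a) (size p).
  (* Both letters lie in [b]: [w] has a shorter [J]-word. *)
  have [e [ep eb]] := cat_split (esym eab) sap; subst p.
  move: P; rewrite E -catA prodw_cat ad => /mulgI P.
  have : len J w <= size (e ++ q ++ r).
    rewrite P; apply: len_leq => s sin; apply: bJ; rewrite eb; move: sin.
    by rewrite !(mem_cat, inE) => /or3P[] ->; rewrite ?orbT.
  by rewrite -sb eb !size_cat /= size_cat /=; lia.
have [[|x' e] [ea]] := cat_split eab (ltnW sap).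
  by move: sap; rewrite ea cats0 ltnn.
case=> ex eqb; subst x'; have [sqe|sqe] := leqP (size e) (size q).
  (* One letter lies in [a] and one in [b]: [p ++ e] represents an element of the coset of [d]
     shorter than [d]. *)
  have [f [eq fb]] := cat_split eqb sqe; subst q.
  have frJ : {subset f ++ r <= J}.
    by move=> s sin; apply: bJ; rewrite fb; move: sin; rewrite !(mem_cat, inE) => /orP[] ->;
      rewrite ?orbT.
  have : size a <= size (p ++ e).
    apply: lena => [s sin|].
      by apply: aS; rewrite ea; move: sin; rewrite !(mem_cat, inE) => /orP[] ->; rewrite ?orbT.
    have -> : prodw (p ++ e) = d * w * (prodw (f ++ r))^-1.
      by rewrite -E P -(catA e) (catA p) (prodw_cat (p ++ e)) mulgK.
    by rewrite -mulgA mulKg; apply: parabolicM => //; apply/parabolicV/parabolic_word.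
  by rewrite ea !size_cat /=; lia.
(* Both letters lie in [a]: [p ++ q ++ f] is a shorter word for [d]. *)
have [[|y' f] [ef]] := cat_split (esym eqb) (ltnW sqe).
  by move: sqe; rewrite ef cats0 ltnn.
case=> ey rb; subst y'; have : size a <= size (p ++ q ++ f).
  apply: lena => [s sin|].
    apply: aS; rewrite ea ef; move: sin.
    by rewrite !(mem_cat, inE) => /or3P[] ->; rewrite ?orbT.
  suff -> : prodw (p ++ q ++ f) = d by rewrite mulVg; apply: parabolic1.
  apply: (@mulIg _ w); rewrite -E P rb -bw -prodw_cat.
  by rewrite -!catA.
by rewrite ea ef !size_cat /= size_cat /=; lia.
Qed.

Lemma len1 : len S 1 = 0.
Proof. by apply/eqP; rewrite -leqn0 -prodw_nil len_leq. Qed.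

Lemma len_eq0 J w : parabolic J w -> len J w = 0 -> w = 1.
Proof. by move=> /len_word[[|s u] [_ <- <-]] // _; rewrite prodw_nil. Qed.

Lemma len_gen_mul s w : s \in S -> len S (s * w) <= (len S w).+1.
Proof.
move=> sS; have [u [uS uw <-]] := len_word (parabolicT w).
rewrite -uw -prodw_cons; apply: (@len_leq _ (s :: u)) => t.
by rewrite inE => /orP[/eqP -> //|/uS //].
Qed.

Lemma lenV w : len S w^-1 = len S w.
Proof.
suff H z : len S z^-1 <= len S z by apply/eqP; rewrite eqn_leq H -{1}[w]invgK H.
have [u [uS uz <-]] := len_word (parabolicT z).
by rewrite -uz -prodw_rev // -size_rev; apply: len_leq => t; rewrite mem_rev => /uS.
Qed.

Lemma len_gen_neq s w : s \in S -> len S (s * w) <> len S w.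
Proof.
move=> sS E; have [u [uS uw su]] := len_word (parabolicT w).
have [v [vS vw sv]] := len_word (parabolicT (s * w)).
have : odd (size v) = odd (size (s :: u)).
  apply: odd_size => //; last by rewrite prodw_cons uw vw.
  by move=> t; rewrite inE => /orP[/eqP -> //|/uS //].
by rewrite sv E -su /=; case: odd.
Qed.

Lemma mul_genK s w : s \in S -> s * (s * w) = w.
Proof. by move=> /gen_sqr ss; rewrite mulgA ss mul1g. Qed.

End Coxeter.

(** * Distances valued in a Coxeter group *)

Section WMetric.
Variables (W : groupType) (S : {fset W}).
Hypothesis cox : coxeter_system S.
Variables (T : Type) (Ch : set T).
Implicit Types (d : T -> T -> W) (C D E : T).

(** The axioms of a Weyl distance. Thickness takes the form of a freedom to avoid any prescribed
    [C1]; as [s] is not 1, [C'] differs from [C] too. *)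
Record thick_wmetric d : Prop := ThickWMetric {
  wm_eq : forall C D, Ch C -> Ch D -> d C D = 1 <-> C = D;
  wm_inv : forall C D, Ch C -> Ch D -> d D C = (d C D)^-1;
  wm_step : forall C C' D s, Ch C -> Ch C' -> Ch D -> s \in S ->
    d C C' = s -> d C' D = d C D \/ d C' D = s * d C D;
  wm_ex : forall C D s, Ch C -> Ch D -> s \in S ->
    exists C', [/\ Ch C', d C C' = s & d C' D = s * d C D];
  wm_thick : forall C C1 s, Ch C -> s \in S ->
    exists C', [/\ Ch C', d C C' = s & C' <> C1] }.

Definition isometric d (c : W -> T) : Prop :=
  (forall x, Ch (c x)) /\ forall x y, d (c x) (c y) = x^-1 * y.

Variable d : T -> T -> W.
Hypothesis wm : thick_wmetric d.

Local Notation l := (len S).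

Lemma wm_stepr C D D' s : Ch C -> Ch D -> Ch D' -> s \in S ->
  d D D' = s -> d C D' = d C D \/ d C D' = d C D * s.
Proof.
move=> cC cD cD' sS ds; rewrite [d C D'](wm_inv wm) // [d C D](wm_inv wm) //.
case: (wm_step wm cD cD' cC sS ds) => ->; first by left.
by right; rewrite invgM (gen_inv cox sS).
Qed.

Lemma wm_trans C D D' s : Ch C -> Ch D -> Ch D' -> s \in S ->
  d C D = s -> d C D' = s -> D <> D' -> d D D' = s.
Proof.
move=> cC cD cD' sS CD CD' DD'; case: (wm_step wm cC cD cD' sS CD) => [->//|].
by rewrite CD' (gen_sqr cox sS) => /(wm_eq wm cD cD').
Qed.

(* The retraction onto an apartment centred at A is 1-Lipschitz. *)
Lemma wm_lip A B D : Ch A -> Ch B -> Ch D -> l ((d A D)^-1 * d A B) <= l (d D B).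
Proof.
move=> cA cB cD; have [u [uS]] := len_word (parabolicT cox (d D B)).
move=> + <-; elim: u D cD uS => [|s u IH] D cD uS.
  by move=> /esym; rewrite prodw_nil => /(wm_eq wm cD cB) ->; rewrite mulVg len1.
have sS := uS s (mem_head _ _); rewrite prodw_cons => E.
have [D' [cD' DD' D'B]] := wm_ex wm cD cB sS.
have {}IH := IH D' cD' _; have {IH} : l ((d A D')^-1 * d A B) <= size u.
  apply: IH => [t tu|]; first by apply: uS; rewrite inE tu orbT.
  by rewrite D'B -E (mul_genK cox _ sS).
case: (wm_stepr cA cD cD' sS DD') => -> /=; first exact: leqW.
rewrite invgM (gen_inv cox sS) -mulgA => H.
rewrite -(mul_genK cox (_ * d A B) sS); exact: leq_trans (len_gen_mul cox _ sS) _.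
Qed.

(** Were the distance unchanged, [wm_lip] centred at [C] would bound the length of [s * d C D] by
    that of [d C D]. *)
Lemma wm_up C C' D s : Ch C -> Ch C' -> Ch D -> s \in S -> d C C' = s ->
  l (d C D) < l (s * d C D) -> d C' D = s * d C D.
Proof.
move=> cC cC' cD sS CC' lt; case: (wm_step wm cC cC' cD sS CC') => // E.
by have := wm_lip cC cD cC'; rewrite CC' (gen_inv cox sS) E leqNgt lt.
Qed.

(** Uniqueness of the projection of [D] to an [s]-panel: two distinct candidates would be
    [s]-adjacent, and by [wm_up] the second would be farther from [D] than the first. *)
Lemma wm_gate C E E' D s : Ch C -> Ch E -> Ch E' -> Ch D -> s \in S ->
  d C E = s -> d C E' = s -> l (s * d C D) < l (d C D) ->
  d E D = s * d C D -> d E' D = s * d C D -> E = E'.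
Proof.
move=> cC cE cE' cD sS CE CE' lt ED E'D; apply: contrapT => EE'.
have := wm_up cE cE' cD sS (wm_trans cC cE cE' sS CE CE' EE').
by rewrite ED (mul_genK cox _ sS) // => /(_ lt); rewrite E'D => /(congr1 l) E0;
  move: lt; rewrite E0 ltnn.
Qed.

(** * Partial isometries and their extension *)

Lemma len_rev_lt s w : s \in S -> ~ l (s * w) < l w -> l w < l (s * w).
Proof.
by move=> sS; have := @len_gen_neq _ _ cox s w sS; case: (ltngtP (l (s * w)) (l w)).
Qed.

(* A partial isometry is given by its graph, so that Zorn_bigcup applies. *)
Definition piso (G : set (W * T)) : Prop :=
  forall p q, G p -> G q -> Ch p.2 /\ d p.2 q.2 = p.1^-1 * q.1.

Lemma piso_fun G x C D : piso G -> G (x, C) -> G (x, D) -> C = D.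
Proof.
move=> iG GC GD; have [cC E] := iG _ _ GC GD; have [cD _] := iG _ _ GD GC.
by apply/(wm_eq wm cC cD); rewrite E mulVg.
Qed.

Lemma piso_add G y D : piso G -> Ch D -> (forall p, G p -> d D p.2 = y^-1 * p.1) ->
  piso (G `|` [set (y, D)])%classic.
Proof.
move=> iG cD GD p q [Gp|->] [Gq|->] /=.
- exact: iG.
- have [cp _] := iG _ _ Gp Gp; split => //.
  by rewrite (wm_inv wm) // GD // invgM invgK.
- by split => //; exact: GD.
- by split => //; rewrite mulVg; apply/(wm_eq wm).
Qed.

Lemma piso_step_free G w C s D : piso G -> G (w, C) -> s \in S -> Ch D -> d C D = s ->
  (forall p, G p -> l (w^-1 * p.1) < l (s * (w^-1 * p.1))) ->
  forall p, G p -> d D p.2 = (w * s)^-1 * p.1.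
Proof.
move=> iG Gw sS cD CD up p Gp; have [cC E] := iG _ _ Gw Gp.
have [cp _] := iG _ _ Gp Gp; rewrite (wm_up cC cD cp sS CD) E /=.
  by rewrite invgM (gen_inv cox sS) mulgA.
exact: up.
Qed.

(** If some [p0] is nearer to [w * s] than to [w], the new chamber must be the projection of [p0.2]
    to the [s]-panel of [C]; the point is that all such [p0] give the same projection. Otherwise any
    [s]-neighbour of [C] will do. *)
Lemma piso_step G w C s : piso G -> G (w, C) -> s \in S ->
  exists D, [/\ Ch D, d C D = s & forall p, G p -> d D p.2 = (w * s)^-1 * p.1].
Proof.
move=> iG Gw sS; have [cC _] := iG _ _ Gw Gw.
have [|nx] := pselect (exists2 p, G p & l (s * (w^-1 * p.1)) < l (w^-1 * p.1)); last first.
  have [D [cD CD _]] := wm_thick wm C cC sS; exists D; split => //.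
  apply: (piso_step_free iG Gw sS cD CD) => p Gp; apply: len_rev_lt => // lt;
    apply: nx; by exists p.
move=> [p0 Gp0 lt0]; have [cp0 E0] := iG _ _ Gw Gp0; have [cp0' _] := iG _ _ Gp0 Gp0.
have [D [cD CD Dp0]] := wm_ex wm cC cp0' sS.
exists D; split => // p Gp; have [_ E] := iG _ _ Gw Gp; have [cp _] := iG _ _ Gp Gp.
rewrite invgM (gen_inv cox sS) -mulgA.
have [lt|/(len_rev_lt sS) lt] := pselect (l (s * (w^-1 * p.1)) < l (w^-1 * p.1)); last first.
  by rewrite (wm_up cC cD cp sS CD) E.
have [D' [cD' CD' D'p]] := wm_ex wm cC cp sS.
(* If the projection [D'] of [p.2] were not [D], it would have the same distance to [p0.2] as [C].
   The retraction centred at [p0.2] then forbids [D'] to be nearer to [p.2] than [C]. *)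
have [<-|DD'] := pselect (D' = D); first by rewrite D'p E.
have DD := wm_trans cC cD cD' sS CD CD' (nesym DD').
have D'p0 : d D' p0.2 = w^-1 * p0.1.
  by rewrite (wm_up cD cD' cp0' sS DD) Dp0 E0 (mul_genK cox _ sS).
have := wm_lip cp0' cp cD'; have [_ ->] := iG _ _ Gp0 Gp.
rewrite (wm_inv wm cD' cp0') D'p0 invgK D'p E /= -mulgA mulVKg.
by rewrite leqNgt lt.
Qed.

(** [Y] is the set to be covered and [good] the condition on the chambers added. A step may supply
    any missing element of [Y], so the domain can grow along galleries. *)
Lemma piso_zorn (G0 : set (W * T)) (Y : set W) (good : W -> T -> Prop) : piso G0 ->
  (forall G, piso G -> (G0 `<=` G)%classic ->
     (forall p, G p -> G0 p \/ (Y p.1 /\ good p.1 p.2)) ->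
     (exists y, Y y /\ ~ exists D, G (y, D)) ->
     exists y D, [/\ Y y, ~ (exists D', G (y, D')), good y D, Ch D &
       forall p, G p -> d D p.2 = y^-1 * p.1]) ->
  exists G, [/\ piso G, (G0 `<=` G)%classic,
    forall p, G p -> G0 p \/ (Y p.1 /\ good p.1 p.2) &
    forall y, Y y -> exists D, G (y, D)].
Proof.
move=> iG0 step.
(* [G0] is kept apart from [H] so that the empty union of the empty chain satisfies [P]. *)
pose P (H : set (W * T)) := piso (G0 `|` H)%classic /\ forall p, H p -> Y p.1 /\ good p.1 p.2.
have [A [[iA gA] Amax]] : exists A, P A /\ forall B, (A `<` B)%classic -> ~ P B.
  apply: Zorn_bigcup => F FP tF; split=> [p q|p [H FH Hp]]; last by have [_] := FP _ FH; apply.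
  move=> [Gp|[H FH Hp]] [Gq|[K FK Kq]]; first exact: iG0.
  - by have [iK _] := FP _ FK; apply: iK; [left|right].
  - by have [iH _] := FP _ FH; apply: iH; [right|left].
  - have [HK|KH] := tF _ _ FH FK.
      by have [iK _] := FP _ FK; apply: iK; right => //; apply: HK.
    by have [iH _] := FP _ FH; apply: iH; right => //; apply: KH.
exists (G0 `|` A)%classic; split => //.
  by move=> p [G0p|/gA]; [left|right].
move=> y Yy; apply: contrapT => ny.
have [|p [G0p|/gA]||z [D [Yz nz gz cD Dd]]]
  := step _ iA; [by move=> p Hp; left|by left|by right|by exists y|].
apply: (Amax (A `|` [set (z, D)])%classic); last split.
- split; first by move=> p Hp; left.
  by move=> sub; apply: nz; exists D; right; apply: sub; right.
- by rewrite classical_sets.setUA; exact: piso_add.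
- by move=> p [/gA|->].
Qed.

(* With C = c 1, D = c v and D' = c (v s), at most one chamber t-adjacent to C is
   nearer to D' than C.  By thickness there is another one C', and
   d C' D = t v, d C' D' = v s with D and D' s-adjacent. *)
Lemma exchange c s t v : isometric d c -> s \in S -> t \in S ->
  l v < l (t * v) -> l v < l (v * s) -> l (t * (v * s)) < l (v * s) -> t * v = v * s.
Proof.
move=> [cc dc] sS tS ltv lvs ltvs.
have d1 x : d (c 1) (c x) = x by rewrite dc invg1 mul1g.
have [C' [cC' CC' C'n]] := wm_thick wm (c t) (cc 1) tS.
have C'D : d C' (c v) = t * v by rewrite (wm_up (cc 1) cC' (cc v) tS CC') d1.
have CtC' : d (c t) C' = t by apply: (wm_trans (cc 1)) => //; exact/nesym.
have tD' : d (c t) (c (v * s)) = t * (v * s) by rewrite dc (gen_inv cox tS).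
have C'D' : d C' (c (v * s)) = v * s.
  by rewrite (wm_up (cc t) cC' (cc _) tS CtC') tD' (mul_genK cox _ tS).
have vvs : d (c v) (c (v * s)) = s by rewrite dc mulKg.
case: (wm_stepr cC' (cc v) (cc _) sS vvs); rewrite C'D' C'D // => E.
by move: ltvs; rewrite mulgA -E ltnn.
Qed.

Lemma len_descent w : w <> 1 -> exists2 s, s \in S & l (s * w) < l w.
Proof.
move=> w1; have [[|s u] [uS uw su]] := len_word (parabolicT cox w).
  by case: w1; rewrite -uw prodw_nil.
have sS := uS s (mem_head _ _); exists s => //.
rewrite -su -uw prodw_cons (mul_genK cox _ sS) //= ltnS; apply: len_leq => t tu.
by apply: uS; rewrite inE tu orbT.
Qed.

Lemma gen_ind (P : W -> Prop) : P 1 -> (forall w s, P w -> s \in S -> P (w * s)) ->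
  forall w, P w.
Proof.
move=> P1 Ps w; have [u [uS <- _]] := len_word (parabolicT cox w).
elim/last_ind: u uS => [|u s IH] uS; first by rewrite prodw_nil.
rewrite -cats1 prodw_cat prodw_cons prodw_nil mulg1; apply: Ps.
  by apply: IH => t tu; apply: uS; rewrite mem_rcons inE tu orbT.
by apply: uS; rewrite mem_rcons mem_head.
Qed.

(** One-step form of gallery convexity: a step from [w] towards [y] stays in [X]. *)
Definition wconvex (X : set W) : Prop := forall w y s, X w -> X y -> s \in S ->
  l (s * (w^-1 * y)) < l (w^-1 * y) -> X (w * s).

Lemma convex_extension c (X : set W) : isometric d c -> (exists x, X x) -> wconvex X ->
  exists b, [/\ isometric d b, forall x, X x -> b x = c x &
    forall x y, b x = c y -> X x].
Proof.
move=> ic [x0 Xx0] Xconv; have [cc dc] := ic.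
pose G0 : set (W * T) := [set p | X p.1 /\ p.2 = c p.1]%classic.
pose Y : set W := [set y | exists w s, [/\ X w, s \in S, y = w * s & ~ X y]]%classic.
have iG0 : piso G0 by move=> [x C] [y D] [/= Xx ->] [/= Xy ->]; split.
(* First extension: the outer neighbours of [X] receive chambers outside the image of [c]. *)
have [|G1 [iG1 G01 G1s G1t]] := piso_zorn (Y := Y) (good := fun _ D => forall z, D <> c z) iG0.
  move=> G iG G0G Gs [_ [[w [t [Xw tS -> nX]]] nG]].
  have Gw x : X x -> G (x, c x) by move=> Xx; apply: G0G.
  exists (w * t).
  have [[p0 Gp0 lt0]|nx] := pselect (exists2 p, G p & l (t * (w^-1 * p.1)) < l (w^-1 * p.1)).
    have [D [cD CD GD]] := piso_step iG (Gw w Xw) tS.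
    exists D; split => //; first by exists w, t.
    move=> z ez; have {}ez : D = c (w * t).
      by move: CD; rewrite ez dc => <-; rewrite mulVKg.
    (* By convexity [p0] does not come from [X], so it was added earlier at some [w' * s]. *)
    case: (Gs _ Gp0) => [[Xp _]|]; first by apply: nX; apply: (Xconv w p0.1).
    move: p0 Gp0 lt0 => [y E] /= Gp0 lt0 [[w' [s [Xw' sS ey nY]]] nE].
    subst y; set v := w^-1 * w'.
    have ltv : l v < l (t * v).
      by apply: len_rev_lt => // lt; apply: nX; apply: (Xconv w w').
    have vi : w'^-1 * w = v^-1 by rewrite /v invgM invgK.
    have lvs : l v < l (v * s).
      rewrite -(lenV cox v) -(lenV cox (v * s)) (invgM v s) (gen_inv cox sS).
      by apply: len_rev_lt => // lt; apply: nY; apply: (Xconv w' w) => //; rewrite vi.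
    (* That is, [w * t * w^-1] and [w' * s * w'^-1] are the same reflection. *)
    have tvs : t * v = v * s.
      by apply: (exchange ic) => //; move: lt0; rewrite /v !mulgA.
    have tvs' : v^-1 * t = s * v^-1.
      by rewrite -{1}(gen_inv cox tS) -{1}(gen_inv cox sS) -!invgM tvs.
    have [cE Ew] := iG _ _ Gp0 (Gw _ Xw'); have [_ wE] := iG _ _ (Gw _ Xw') Gp0.
    (* [E] and [c (w' * s)] are both the projection of [c (w * t)] to the [s]-panel of [c w'], hence
       equal, although [E] was chosen outside the image of [c]. *)
    apply: (nE (w' * s)); have ED : d E (c (w * t)) = v^-1.
      rewrite -ez (wm_inv wm cD cE) (GD _ Gp0) /= invgM invgK (invgM w' s) (gen_inv cox sS).
      by rewrite -mulgA (mulgA w'^-1) vi tvs' (mul_genK cox _ sS).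
    have cwD : d (c w') (c (w * t)) = s * v^-1 by rewrite dc mulgA -tvs' /v invgM invgK.
    apply: (@wm_gate (c w') _ _ (c (w * t)) s) => //.
    - by rewrite /= in wE; rewrite wE mulKg.
    - by rewrite dc mulKg.
    - by rewrite cwD (mul_genK cox _ sS) -{1}(gen_inv cox sS) -invgM !(lenV cox).
    - by rewrite cwD (mul_genK cox _ sS).
    - by rewrite dc invgM (gen_inv cox sS) -mulgA -dc.
  (* Nothing is forced here. The only [t]-neighbour of [c w] in the image of [c] is [c (w * t)], and
     thickness avoids it. *)
  have [D [cD CD Dn]] := wm_thick wm (c (w * t)) (cc w) tS.
  exists D; split => //; first by exists w, t.
    by move=> z ez; apply: Dn; move: CD; rewrite ez dc => <-; rewrite mulVKg.
  apply: (piso_step_free iG (Gw _ Xw)) => // p Gp; apply: len_rev_lt => // lt.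
  by apply: nx; exists p.
(* Second extension, to all of [W]: between [x0] and a missing [y] some step leaves the domain, and
   [piso_step] fills that place. *)
have [|G2 [iG2 G12 _ G2t]] := piso_zorn (Y := setT) (good := fun _ _ => True) iG1.
  move=> G iG G1G _ [y [_ ny]].
  suff [w [s [sS [C Gw] ns]]] : exists w s, [/\ s \in S, exists C, G (w, C) &
      ~ exists D, G (w * s, D)].
    by have [D [cD _ GD]] := piso_step iG Gw sS; exists (w * s), D.
  apply: contrapT => no; apply: ny; rewrite -[y](mulVKg x0).
  elim/gen_ind: (x0^-1 * y) => [|w s Gw sS].
    by rewrite mulg1; exists (c x0); apply/G1G/G01.
  by apply: contrapT => ns; apply: no; exists (x0 * w), s; rewrite -mulgA.
have /choice[b bG] : forall x, exists D, G2 (x, D) by move=> x; apply: G2t.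
have bc x : X x -> b x = c x.
  by move=> Xx; apply: (piso_fun iG2 (bG x)); apply/G12/G01.
have ib : isometric d b by split => [x|x y];
  [have [] := iG2 _ _ (bG x) (bG x) | have [] := iG2 _ _ (bG x) (bG y)].
exists b; split => // x y bxy; have [cb db] := ib.
(* Walk inside [X] towards [x]. If a step to [w * s] left [X], then [b (w * s)] and [c (w * s)]
   would both be the projection of [b x = c y] to the same panel, against the choice of [b (w * s)]
   outside the image of [c]. *)
suff H n w : X w -> l (w^-1 * x) <= n -> X x by exact: (H _ x0).
elim: n w => [|n IH] w Xw.
  rewrite leqn0 => /eqP /(len_eq0 (parabolicT cox _)) E.
  by have := mulVKg w x; rewrite E mulg1 => <-.
have [E _|] := pselect (w^-1 * x = 1); first by have := mulVKg w x; rewrite E mulg1 => <-.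
move=> /len_descent[s sS lt] le; apply: (IH (w * s)); last first.
  by rewrite invgM (gen_inv cox sS) -mulgA -ltnS (leq_trans lt le).
apply: contrapT => nX; have [|E G1E] := G1t (w * s); first by exists w, s.
have [[//]|[_ /= nE]] := G1s _ G1E; apply: (nE (w * s)).
have -> : E = b (w * s) by apply: (piso_fun iG2 _ (bG _)); apply: G12.
apply: (@wm_gate (c w) _ _ (b x) s) => //.
- by rewrite -(bc _ Xw) db mulKg.
- by rewrite dc mulKg.
- by rewrite -(bc _ Xw) db.
- by rewrite -(bc _ Xw) !db invgM (gen_inv cox sS) mulgA.
- by rewrite bxy !dc invgM (gen_inv cox sS) mulgA.
Qed.

End WMetric.

(** * Coxeter complexes *)

Section Labelling.
Variables (V : choiceType) (W : groupType) (S : {fset W}).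
Hypothesis cox : coxeter_system S.
Implicit Types (J K : {fset W}) (s t w x y z : W) (A B : {fset V}).

Definition fim (f : V -> V) A : {fset V} := [fset f v | v in A]%fset.

Lemma fimP f A v : reflect (exists2 w, w \in A & v = f w) (v \in fim f A).
Proof. exact: imfsetP. Qed.

Lemma mem_fim f A v : v \in A -> f v \in fim f A.
Proof. by move=> vA; apply/fimP; exists v. Qed.

Lemma fim_comp f g A : fim (g \o f) A = fim g (fim f A).
Proof.
apply/fsetP => v; apply/fimP/fimP => [[w wA ->]|[_ /fimP[w wA ->] ->]].
  by exists (f w) => //; apply: mem_fim.
by exists w.
Qed.

Lemma fim_id f A : (forall v, v \in A -> f v = v) -> fim f A = A.
Proof.
move=> fA; apply/fsetP => v; apply/fimP/idP => [[w wA ->]|vA]; first by rewrite fA.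
by exists v; rewrite ?fA.
Qed.

Lemma fimS f A B : (A `<=` B)%fset -> (fim f A `<=` fim f B)%fset.
Proof. by move=> /fsubsetP AB; apply/fsubsetP => _ /fimP[v /AB vB ->]; apply: mem_fim. Qed.

Lemma fim1 f v : fim f [fset v]%fset = [fset f v]%fset.
Proof.
apply/fsetP => w; rewrite inE; apply/fimP/eqP => [[u /[!inE] /eqP -> //]|->].
by exists v; rewrite ?inE.
Qed.

Definition lchamber (vert : W -> W -> V) x : {fset V} := [fset vert x s | s in S]%fset.

(* vert x s is the vertex of type s of the chamber x of the Coxeter complex. *)
Record labelling (Sigma : set {fset V}) (vert : W -> W -> V) : Prop := Labelling {
  lab_simplex : forall A, Sigma A <-> exists x, (A `<=` lchamber vert x)%fset;
  lab_vert : forall x y s t, s \in S -> t \in S ->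
    vert x s = vert y t <-> s = t /\ parabolic (S `\ s)%fset (x^-1 * y);
  lab_face : forall x y K, (K `<=` S)%fset -> (forall s, s \in K -> vert x s = vert y s) ->
    parabolic (S `\` K)%fset (x^-1 * y) }.

(** * Vertices and chambers of a Coxeter complex as cosets *)

Definition coset x J : set W := [set x * z | z in parabolic J]%classic.

Lemma cosetE x J y : coset x J y <-> parabolic J (x^-1 * y).
Proof.
split=> [[z Jz <-]|Jz]; first by rewrite mulKg.
by exists (x^-1 * y); rewrite ?mulVKg.
Qed.

Lemma coset_refl x J : coset x J x.
Proof. by apply/cosetE; rewrite mulVg; apply: parabolic1. Qed.

Lemma coset_sub x y J K : (J `<=` S)%fset -> (K `<=` S)%fset ->
  (coset x J `<=` coset y K)%classic <-> (J `<=` K)%fset /\ coset y K x.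
Proof.
move=> JS KS; split=> [sub|[JK /cosetE yx] z /cosetE xz].
  have yx := sub _ (coset_refl x J); split => //; apply/fsubsetP => s sJ.
  apply: (parabolic_mem cox KS (fsubsetP JS _ sJ)).
  have /cosetE : coset y K (x * s) by apply: sub; exists s => //; apply: parabolic_gen.
  move/cosetE : yx => yx; rewrite mulgA => yxs.
  by rewrite -[s](mulKg (y^-1 * x)); apply: parabolicM => //; apply: (parabolicV cox).
apply/cosetE; rewrite -[z](mulVKg x) mulgA; apply: parabolicM => //.
exact: parabolicS xz.
Qed.

Lemma coset_eq x y J : (J `<=` S)%fset -> coset y J x -> coset x J = coset y J.
Proof.
move=> JS yx; apply/seteqP; split; apply/coset_sub => //; split => //.
by move/cosetE: yx => /(parabolicV cox JS); rewrite invgM invgK => ?; apply/cosetE.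
Qed.

(** Since [phi] reverses inclusion, the empty simplex goes to [W], the vertices to the cosets of
    maximal proper parabolic subgroups, and the chambers to singletons. *)
Lemma coxeter_labelling (v0 : V) (Sigma : set {fset V}) (phi : {fset V} -> set W) :
  simplicial_complex Sigma -> set_bij Sigma (standard_coset S) phi ->
  (forall A B, Sigma A -> Sigma B -> (A `<=` B)%fset <-> (phi B `<=` phi A)%classic) ->
  exists vert, labelling Sigma vert.
Proof.
move=> [S0 Sdown] [phiS phi_inj phi_surj] phi_le.
have phiP A : Sigma A -> exists x J, (J `<=` S)%fset /\ phi A = coset x J.
  by move=> /phiS[x [J JS ->]]; exists x, J.
have sx x J : (J `<=` S)%fset -> exists2 A, Sigma A & phi A = coset x J.
  by move=> JS; apply: phi_surj; exists x, J.
have phi0 x : coset x S = phi fset0.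
  have [A SA eA] := sx x S (fsubset_refl S).
  have [y [J [JS eJ]]] := phiP _ S0.
  have := (phi_le _ _ S0 SA).1 (fsub0set A);
    rewrite eA eJ => /(coset_sub _ _ (fsubset_refl S) JS)[SJ yx].
  have -> : J = S by apply/eqP; rewrite eqEfsubset JS SJ.
  apply: coset_eq => //; have -> // : S = J by apply/eqP; rewrite eqEfsubset JS SJ.
have eqphi A B : Sigma A -> Sigma B -> phi A = phi B -> A = B.
  by move=> SA SB; apply: phi_inj; rewrite inE.
have DS s : (S `\ s `<=` S)%fset by apply: fsubD1set.
have vex x s : s \in S ->
  exists v, Sigma [fset v]%fset /\ phi [fset v]%fset = coset x (S `\ s)%fset.
  move=> sS; have [A SA eA] := sx x _ (DS s).
  have nS : ~ (S `<=` S `\ s)%fset by move=> /fsubsetP/(_ s sS); rewrite !inE eqxx.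
  have [A0|[v vA]] := fset_0Vmem A.
    by move: eA; rewrite A0 -(phi0 x) => e;
      case: nS; apply: ((coset_sub x x _ _).1 _).1 => //; rewrite e.
  have Sv : Sigma [fset v]%fset by apply: Sdown SA _; rewrite fsub1set.
  (* The coset of [v] contains that of [A], and its type [K] is not [S] because [v] is not the empty
     simplex. As only [s] is missing from the type of [A], the two cosets agree. *)
  exists v; split => //; have [y [K [KS eK]]] := phiP _ Sv.
  have := (phi_le _ _ Sv SA).1; rewrite fsub1set => /(_ vA); rewrite eA eK.
  move=> /(coset_sub _ _ (DS s) KS)[sK yx]; rewrite -(coset_eq KS yx); congr coset.
  apply/eqP; rewrite eqEfsubset sK andbT; apply/fsubsetP => t tK.
  rewrite !inE (fsubsetP KS _ tK) andbT; apply/negP => /eqP ts; subst t.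
  have KSe : K = S.
    apply/eqP; rewrite eqEfsubset KS; apply/fsubsetP => t tS.
    by have [->//|ts] := eqVneq t s; apply: (fsubsetP sK); rewrite !inE ts.
  have : [fset v]%fset = fset0 by apply: eqphi => //; rewrite eK KSe phi0.
  by move/fsetP/(_ v); rewrite !inE eqxx.
have /choice[vert vertP] : forall p : W * W, exists v, p.2 \in S ->
    Sigma [fset v]%fset /\ phi [fset v]%fset = coset p.1 (S `\ p.2)%fset.
  (* [v0] is a junk value for labels outside [S]. *)
  move=> [x s]; have [sS|nS] := boolP (s \in S); last by exists v0.
  by have [v ?] := vex x s sS; exists v.
pose vt x s := vert (x, s).
have vtS x s : s \in S -> Sigma [fset vt x s]%fset by move=> sS; have [] := vertP (x, s) sS.
have vtE x s : s \in S -> phi [fset vt x s]%fset = coset x (S `\ s)%fset.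
  by move=> sS; have [] := vertP (x, s) sS.
have vertex_ex v x : Sigma [fset v]%fset -> phi [fset v]%fset x -> exists2 s, s \in S & v = vt x s.
  move=> Sv; have [y [J [JS eJ]]] := phiP _ Sv; rewrite eJ => yx.
  have [s sS sJ] : exists2 s, s \in S & s \notin J.
    apply: contrapT => no; have SJ : J = S.
      apply/eqP; rewrite eqEfsubset JS; apply/fsubsetP => s sS.
      by apply: contrapT => /negP sJ; apply: no; exists s.
    have : [fset v]%fset = fset0 by apply: eqphi => //; rewrite eJ SJ phi0.
    by move/fsetP/(_ v); rewrite !inE eqxx.
  exists s => //; have : ([fset vt x s] `<=` [fset v])%fset.
    apply/(phi_le _ _ (vtS x s sS) Sv); rewrite eJ vtE // -(coset_eq JS yx).
    apply/coset_sub => //; split; last exact: coset_refl.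
    apply/fsubsetP => t tJ; rewrite !inE (fsubsetP JS _ tJ) andbT.
    by apply: contra sJ => /eqP <-.
  by rewrite fsub1set inE => /eqP.
have chP x : Sigma (lchamber vt x) /\ phi (lchamber vt x) = coset x fset0.
  have [C SC eC] := sx x fset0 (fsub0set _).
  suff <- : C = lchamber vt x by [].
  apply/fsetP => v; apply/idP/imfsetP => [vC|[s /= sS ->]].
    have Sv : Sigma [fset v]%fset by apply: Sdown SC _; rewrite fsub1set.
    have [|s sS ->] := vertex_ex v x Sv; last by exists s.
    apply: ((phi_le _ _ Sv SC).1); first by rewrite fsub1set.
    by rewrite eC; apply: coset_refl.
  rewrite -fsub1set; apply/(phi_le _ _ (vtS x s sS) SC); rewrite eC vtE //.
  by apply/coset_sub => //; split; [exact: fsub0set|exact: coset_refl].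
have lchS x := (chP x).1.
have subP A x : Sigma A -> (A `<=` lchamber vt x)%fset <-> phi A x.
  move=> SA; have [SC eC] := chP x.
  split => [/(phi_le _ _ SA SC)|Ax]; first by rewrite eC; apply; apply: coset_refl.
  apply/(phi_le _ _ SA SC); rewrite eC; move: Ax; have [y [J [JS ->]]] := phiP _ SA => yx.
  by apply/coset_sub => //; split => //; exact: fsub0set.
exists vt; split.
- move=> A; split => [SA|[x /Sdown]]; last exact.
  have [x [J [JS eJ]]] := phiP _ SA; exists x; apply/subP => //; rewrite eJ.
  exact: coset_refl.
- move=> x y s t sS tS; split=> [E|[<- xy]].
    have := vtE x s sS; rewrite E vtE // => e.
    have [st1 xy] : (S `\ s `<=` S `\ t)%fset /\ coset y (S `\ t)%fset x
      by apply/coset_sub; rewrite // e.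
    have [st2 yx] : (S `\ t `<=` S `\ s)%fset /\ coset x (S `\ s)%fset y
      by apply/coset_sub; rewrite // e.
    split; last exact/cosetE.
    apply/eqP/negPn/negP => st; have : s \in (S `\ t)%fset by rewrite !inE st.
    by move/(fsubsetP st2); rewrite !inE eqxx.
  have : [fset vt x s]%fset = [fset vt y s]%fset.
    by apply: eqphi; rewrite ?vtE //; [exact: vtS..|apply/esym/coset_eq => //; exact/cosetE].
  by move/fsetP/(_ (vt x s)); rewrite !inE eqxx => /esym/eqP.
(* The shared vertices form a simplex [A], so the coset [phi A] contains [x] and [y]; its type
   avoids [K] because [A] has a vertex of each type in [K]. *)
- move=> x y K KS E; pose A : {fset V} := [fset vt x s | s in K]%fset.
  have Ax : (A `<=` lchamber vt x)%fset.
    by apply/fsubsetP => _ /imfsetP[s /= sK ->];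
      apply/imfsetP; exists s => //=; apply: (fsubsetP KS).
  have Ay : (A `<=` lchamber vt y)%fset.
    apply/fsubsetP => _ /imfsetP[s /= sK ->]; rewrite E //.
    by apply/imfsetP; exists s => //=; apply: (fsubsetP KS).
  have SA : Sigma A by apply: Sdown Ax.
  have /(subP _ _ SA) := Ax; have /(subP _ _ SA) := Ay.
  have [z [J [JS eJ]]] := phiP _ SA; rewrite eJ => zy zx; rewrite -(coset_eq JS zx) in zy eJ.
  move/cosetE: zy; apply: parabolicS; apply/fsubsetP => s sJ.
  rewrite !inE (fsubsetP JS _ sJ) andbT; apply/negP => sK.
  have sS := fsubsetP KS _ sK.
  have : (phi A `<=` phi [fset vt x s]%fset)%classic.
    by apply/phi_le => //; [exact: vtS|rewrite fsub1set; apply/imfsetP; exists s].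
  rewrite eJ vtE // => /(coset_sub _ _ JS (DS s))[/fsubsetP/(_ s sJ)].
  by rewrite !inE eqxx.
Qed.

End Labelling.

(** * The distance of a building *)

Section Isomorphisms.
Variable V : choiceType.
Implicit Types (K L M : set {fset V}) (A B C D : {fset V}) (f g e : V -> V).

Lemma simplicial_isoP K L f : simplicial_iso K L f <->
  [/\ forall A, K A -> L (fim f A), forall A B, K A -> K B -> fim f A = fim f B -> A = B &
      forall B, L B -> exists2 A, K A & B = fim f A].
Proof.
split=> [[fS finj fsurj]|[fS finj fsurj]].
  split=> [A KA|A B KA KB E|B LB]; first exact: fS.
    by apply: finj; rewrite ?inE.
  by have [A KA <-] := fsurj _ LB; exists A.
split=> [A|A B|B LB]; first exact: fS.
  by rewrite !inE => KA KB; apply: finj.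
by have [A KA ->] := fsurj _ LB; exists A.
Qed.

Lemma simplicial_iso_comp K L M f g :
  simplicial_iso K L f -> simplicial_iso L M g -> simplicial_iso K M (g \o f).
Proof.
move=> /simplicial_isoP[f1 f2 f3] /simplicial_isoP[g1 g2 g3]; apply/simplicial_isoP.
have fgE A : fim (g \o f) A = fim g (fim f A) by exact: fim_comp.
split=> [A KA|A B KA KB|B /g3[A LA ->]]; first by rewrite fgE; apply/g1/f1.
  by rewrite !fgE => /g2 E; apply: f2 => //; apply: E; apply: f1.
by have [A' KA ->] := f3 _ LA; exists A'; rewrite ?fgE.
Qed.

Lemma iso_inj K L f u v : simplicial_iso K L f -> K [fset u]%fset -> K [fset v]%fset ->
  f u = f v -> u = v.
Proof.
move=> /simplicial_isoP[_ finj _] Ku Kv E; have : [fset u]%fset = [fset v]%fset.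
  by apply: finj => //; rewrite !fim1 E.
by move/fsetP/(_ u); rewrite !inE eqxx => /esym/eqP.
Qed.

Lemma iso_card K L f A : simplicial_complex K -> simplicial_iso K L f -> K A ->
  #|` fim f A|%fset = #|` A|%fset.
Proof.
move=> [_ Kd] fi KA; apply: card_in_imfset => u v uA vA.
by apply: (iso_inj fi); apply: Kd KA _; rewrite fsub1set.
Qed.

Lemma chamber_above K A : finite_dimensional K -> K A ->
  exists2 C, chamber K C & (A `<=` C)%fset.
Proof.
move=> [n Kn]; move: {2}(n - _) (leqnn (n - #|` A|)) => m; elim: m A => [|m IH] A le KA.
  exists A => //; split => // D KD AD; apply/esym/eqP; rewrite eqEfcard AD.
  by apply: leq_trans (Kn _ KD) _; rewrite -subn_eq0 -leqn0.
have [cA|] := pselect (chamber K A); first by exists A.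
move=> nA; have [D [KD AD DA]] : exists D, [/\ K D, (A `<=` D)%fset & D <> A].
  apply: contrapT => no; apply: nA; split => // D KD AD.
  by apply: contrapT => DA; apply: no; exists D.
have [|C cC DC] := IH D _ KD; last by exists C => //; apply: fsubset_trans DC.
have : #|` A| < #|` D|.
  by apply: fproper_ltn_card; rewrite fproperEneq AD andbT; apply/eqP => /esym.
lia.
Qed.

End Isomorphisms.

Section Building.
Variables (V : choiceType) (Delta Sigma : set {fset V}) (AA : set (set {fset V})).
Variables (W : groupType) (S : {fset W}) (vert : W -> W -> V).
Hypotheses (cox : coxeter_system S) (cc : chamber_complex Delta).
Hypotheses (ap : apartment_system Delta AA) (AAS : AA Sigma).
Hypothesis lab : labelling S Sigma vert.
Implicit Types (s t r w x y z : W) (A B C D : {fset V}) (u v : V) (e f g : V -> V).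

Local Notation c0 := (lchamber S vert).

Lemma mem_c0 x s : s \in S -> vert x s \in c0 x.
Proof. by move=> sS; apply/imfsetP; exists s. Qed.

Lemma c0P x v : reflect (exists2 s, s \in S & v = vert x s) (v \in c0 x).
Proof. exact: imfsetP. Qed.

Lemma vert_inj x s t : s \in S -> t \in S -> vert x s = vert x t -> s = t.
Proof. by move=> sS tS /(lab_vert lab x x sS tS)[]. Qed.

Lemma Sigma_c0 x : Sigma (c0 x).
Proof. by apply/(lab_simplex lab); exists x. Qed.

Lemma Sigma_vert x s : s \in S -> Sigma [fset vert x s]%fset.
Proof. by move=> sS; apply/(lab_simplex lab); exists x; rewrite fsub1set mem_c0. Qed.

Lemma vert_eq x y s : s \in S -> parabolic (S `\ s)%fset (x^-1 * y) -> vert x s = vert y s.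
Proof. by move=> sS xy; apply/(lab_vert lab x y sS sS). Qed.

Lemma vert_adj x r s : s \in S -> r \in S -> s <> r -> vert (x * r) s = vert x s.
Proof.
move=> sS rS sr; apply/esym/vert_eq => //; rewrite mulKg; apply: parabolic_gen.
by rewrite !inE rS andbT; apply/eqP/nesym.
Qed.

Lemma card_c0 x : #|` c0 x|%fset = #|` S|%fset.
Proof. by apply: card_in_imfset => s t sS tS; apply: vert_inj. Qed.

Lemma AA_complex Sigma1 : AA Sigma1 -> simplicial_complex Sigma1.
Proof. by case: ap => H _ _ /H [[]]. Qed.

Lemma AA_sub Sigma1 : AA Sigma1 -> (Sigma1 `<=` Delta)%classic.
Proof. by case: ap => H _ _ /H [[]]. Qed.

Lemma AA_iso Sigma1 Sigma2 A B : AA Sigma1 -> AA Sigma2 ->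
  Sigma1 A -> Sigma1 B -> Sigma2 A -> Sigma2 B ->
  exists g, [/\ simplicial_iso Sigma1 Sigma2 g, forall v, v \in A -> g v = v &
    forall v, v \in B -> g v = v].
Proof.
case: ap => _ _ H A1 A2 a1 b1 a2 b2; have [g gi gf] := H _ _ _ _ A1 A2 a1 b1 a2 b2.
by exists g; split => // v vA; apply: gf; rewrite in_fsetU vA ?orbT.
Qed.

Lemma iso_c0 Sigma1 e A : simplicial_iso Sigma Sigma1 e -> Sigma1 A ->
  exists x, (A `<=` fim e (c0 x))%fset.
Proof.
move=> /simplicial_isoP[_ _ es] /es[B /(lab_simplex lab)[x Bx] ->].
by exists x; apply: fimS.
Qed.

(** A chamber [D] above the image lies in some apartment, and all apartments are isomorphic because
    they share the empty simplex. So [D] has at most as many vertices as [S] has elements, and the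
    image is all of [D]. *)
Lemma chamber_c0 Sigma1 e x : AA Sigma1 -> simplicial_iso Sigma Sigma1 e ->
  chamber Delta (fim e (c0 x)).
Proof.
move=> A1 ei; have [Dc Df _ _] := cc; have [es _ _] := (simplicial_isoP _ _ _).1 ei.
have S1x : Sigma1 (fim e (c0 x)) by apply/es/Sigma_c0.
have [D cD xD] := chamber_above Df (AA_sub A1 S1x).
suff -> : fim e (c0 x) = D by [].
apply/eqP; rewrite eqEfcard xD (iso_card (AA_complex AAS) ei (Sigma_c0 x)) card_c0.
have [_ /(_ _ _ (Dc.1) cD.1)[Sigma2 A2 [_ S2D]] _] := ap.
have [g [gi _ _]]
  := AA_iso A2 A1 (AA_complex A2).1 (AA_complex A2).1 (AA_complex A1).1 (AA_complex A1).1.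
have [gs _ _] := (simplicial_isoP _ _ _).1 gi.
have [y Dy] := iso_c0 ei (gs _ S2D).
rewrite -(iso_card (AA_complex A2) gi S2D); apply: leq_trans (fsubset_leq_card Dy) _.
by rewrite (iso_card (AA_complex AAS) ei (Sigma_c0 y)) card_c0.
Qed.

Lemma chamber_chart Sigma1 e C : AA Sigma1 -> simplicial_iso Sigma Sigma1 e ->
  chamber Delta C -> Sigma1 C -> exists x, C = fim e (c0 x).
Proof.
move=> A1 ei [_ Cmax] /(iso_c0 ei)[x Cx]; exists x; apply/esym/Cmax => //.
by have [] := chamber_c0 x A1 ei.
Qed.

(** Adjacent chambers share all vertices but one. Types within a chamber being distinct, the type of
    the remaining vertex is forced, so correctness spreads from [x0] along galleries. *)
Lemma typed_all x0 (ty : V -> W) e :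
  (forall x s, s \in S -> ty (e (vert x s)) \in S) ->
  (forall x s t, s \in S -> t \in S -> ty (e (vert x s)) = ty (e (vert x t)) -> s = t) ->
  (forall s, s \in S -> ty (e (vert x0 s)) = s) ->
  forall x s, s \in S -> ty (e (vert x s)) = s.
Proof.
move=> tS tinj t0 x; rewrite -[x](mulVKg x0).
elim/(gen_ind cox): (x0^-1 * x) => [|w r IH rS] s sS; first by rewrite mulg1 t0.
rewrite mulgA; set y := x0 * w.
have adj a : a \in S -> a <> r -> ty (e (vert (y * r) a)) = a.
  by move=> aS ar; rewrite vert_adj // IH.
have [->|/eqP] := eqVneq s r; last exact: adj.
apply: contrapT => ne; set a := ty _ in ne; have aS : a \in S by apply: tS.
by case: (ne); apply/esym/(tinj (y * r) _ _ rS aS); rewrite (adj a aS ne).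
Qed.

(* The type of v is read off in an apartment containing v and the base chamber. *)
Definition has_type v s : Prop := exists Sigma1 e w,
  [/\ AA Sigma1, simplicial_iso Sigma Sigma1 e, forall v, v \in c0 1 -> e v = v, s \in S &
      e (vert w s) = v].

(** An isomorphism of the two apartments fixes [v] and the base chamber. Read through the second
    chart, it preserves types on the base chamber, hence everywhere by [typed_all]. *)
Lemma has_type_fun v s1 s2 : has_type v s1 -> has_type v s2 -> s1 = s2.
Proof.
move=> [Sigma1 [e1 [w1 [A1 i1 f1 s1S v1]]]] [Sigma2 [e2 [w2 [A2 i2 f2 s2S v2]]]].
have [e1s _ _] := (simplicial_isoP _ _ _).1 i1.
have [e2s e2i e2j] := (simplicial_isoP _ _ _).1 i2.
have S1v : Sigma1 [fset v]%fset by rewrite -v1 -fim1; apply/e1s/Sigma_vert.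
have S2v : Sigma2 [fset v]%fset by rewrite -v2 -fim1; apply/e2s/Sigma_vert.
have S1c : Sigma1 (c0 1) by rewrite -(fim_id f1); apply/e1s/Sigma_c0.
have S2c : Sigma2 (c0 1) by rewrite -(fim_id f2); apply/e2s/Sigma_c0.
have [g [gi gc gv]] := AA_iso A1 A2 S1c S1v S2c S2v.
pose ty u := xget 1 [set s | s \in S /\ exists w, e2 (vert w s) = u]%classic.
have tyE w s : s \in S -> ty (e2 (vert w s)) = s.
  move=> sS; apply: xget_unique; first by split => //; exists w.
  move=> t [tS [y E]]; have := iso_inj i2 (Sigma_vert y tS) (Sigma_vert w sS) E.
  by case/(lab_vert lab y w tS sS).
have gei := simplicial_iso_comp i1 gi.
have [ges _ _] := (simplicial_isoP _ _ _).1 gei.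
have ge x : exists y, forall s, s \in S ->
  exists2 t, t \in S & (g \o e1) (vert x s) = e2 (vert y t).
  have [y sub] := iso_c0 i2 (ges _ (Sigma_c0 x)); exists y => s sS.
  have /(fsubsetP sub)/fimP[_ /c0P[t tS ->] E] := mem_fim (g \o e1) (mem_c0 x sS).
  by exists t.
have := @typed_all 1 ty (g \o e1) _ _ _ w1 _ s1S; rewrite /= v1 gv ?inE // -v2 tyE //.
move=> -> //.
- by move=> x s sS; have [y /(_ s sS)[t tS /= ->]] := ge x; rewrite tyE.
- move=> x s t sS tS; have [y H] := ge x.
  have [a aS /= Ea] := H _ sS; have [b bS /= Eb] := H _ tS.
  rewrite Ea Eb !tyE // => ab; subst b; apply: (vert_inj sS tS (x := x)).
  by apply: (iso_inj gei); [exact: Sigma_vert..|rewrite /= Ea Eb].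
- by move=> s sS; rewrite (f1 _ (mem_c0 1 sS)) (gc _ (mem_c0 1 sS)) -(f2 _ (mem_c0 1 sS)) tyE.
Qed.

Definition vtype v : W := xget 1 [set s | has_type v s]%classic.

Definition typed_chart Sigma1 e : Prop :=
  [/\ AA Sigma1, simplicial_iso Sigma Sigma1 e &
      forall x s, s \in S -> vtype (e (vert x s)) = s].

Lemma chart_base Sigma1 : AA Sigma1 -> Sigma1 (c0 1) -> exists e, typed_chart Sigma1 e.
Proof.
move=> A1 S1c; have [e [ei ef _]] := AA_iso AAS A1 (Sigma_c0 1) (Sigma_c0 1) S1c S1c.
exists e; split => // x s sS; apply: xget_unique; first by exists Sigma1, e, x.
by move=> t ht; apply: (has_type_fun ht); exists Sigma1, e, x.
Qed.

Lemma base_apartment A : Delta A -> exists Sigma1 e, typed_chart Sigma1 e /\ Sigma1 A.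
Proof.
move=> DA; have [_ /(_ _ _ (AA_sub AAS (Sigma_c0 1)) DA)[Sigma1 A1 [S1c S1A]] _] := ap.
by have [e te] := chart_base A1 S1c; exists Sigma1, e.
Qed.

Lemma vtype_chamber C : chamber Delta C ->
  [/\ forall v, v \in C -> vtype v \in S,
      forall u v, u \in C -> v \in C -> vtype u = vtype v -> u = v &
      forall s, s \in S -> exists2 v, v \in C & vtype v = s].
Proof.
move=> cC; have [Sigma1 [e [[A1 ei te] S1C]]] := base_apartment cC.1.
have [x ->] := chamber_chart A1 ei cC S1C.
split=> [_ /fimP[_ /c0P[s sS ->] ->]|_ _ /fimP[_ /c0P[s sS ->] ->] /fimP[_ /c0P[t tS ->] ->]|s sS].
- by rewrite te.
- by rewrite !te // => ->.
- by exists (e (vert x s)); [apply/mem_fim/mem_c0|rewrite te].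
Qed.

Lemma chart_transport Sigma1 Sigma2 e g x0 : typed_chart Sigma1 e -> AA Sigma2 ->
  simplicial_iso Sigma1 Sigma2 g -> (forall v, v \in fim e (c0 x0) -> g v = v) ->
  typed_chart Sigma2 (g \o e).
Proof.
move=> [A1 ei te] A2 gi gf; have gei := simplicial_iso_comp ei gi; split => //.
have ch x := vtype_chamber (chamber_c0 x A2 gei).
have mem x s : s \in S -> (g \o e) (vert x s) \in fim (g \o e) (c0 x).
  by move=> sS; apply/mem_fim/mem_c0.
apply: (@typed_all x0) => [x s sS|x s t sS tS E|s sS].
- by have [H _ _] := ch x; apply/H/mem.
- have [_ H _] := ch x; apply: (vert_inj sS tS (x := x)).
  by apply: (iso_inj gei (Sigma_vert _ sS) (Sigma_vert _ tS)); apply: H => //; apply: mem.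
- by rewrite /= gf ?te //; apply/mem_fim/mem_c0.
Qed.

(** [Sigma1] need not contain the base chamber. Its chart is carried over from an apartment through
    the base chamber and a chamber [C] of [Sigma1], by an isomorphism fixing [C]. *)
Lemma chart_ex Sigma1 : AA Sigma1 -> exists e, typed_chart Sigma1 e.
Proof.
move=> A1; have E0 Sigma2 : AA Sigma2 -> Sigma2 fset0 by move=> /AA_complex[].
have [e1 [i1 _ _]] := AA_iso AAS A1 (E0 _ AAS) (E0 _ AAS) (E0 _ A1) (E0 _ A1).
have cC := chamber_c0 1 A1 i1; set C := fim _ _ in cC.
have [es _ _] := (simplicial_isoP _ _ _).1 i1; have S1C : Sigma1 C by apply/es/Sigma_c0.
have [Sigma2 [e [te S2C]]] := base_apartment cC.1; have [A2 ei _] := te.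
have [g [gi gC _]] := AA_iso A2 A1 S2C S2C S1C S1C.
have [x Ce] := chamber_chart A2 ei cC S2C.
by exists (g \o e); apply: (@chart_transport _ _ _ _ x te A1 gi); rewrite -Ce.
Qed.

(** * The Weyl distance read off in a common apartment *)

Definition wdist_rel C D w : Prop := exists Sigma1 e x y,
  [/\ typed_chart Sigma1 e, C = fim e (c0 x), D = fim e (c0 y) & w = x^-1 * y].

Lemma chart_sub Sigma1 e x y K : typed_chart Sigma1 e -> (K `<=` S)%fset ->
  (forall s, s \in K -> e (vert x s) \in fim e (c0 y)) <-> parabolic (S `\` K)%fset (x^-1 * y).
Proof.
move=> [A1 ei te] KS; split=> [H|xy s sK].
  apply: (lab_face lab) => // s sK; have sS := fsubsetP KS _ sK.
  have /fimP[_ /c0P[t tS ->] E] := H s sK.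
  have st : s = t by rewrite -(te x s sS) -(te y t tS) E.
  by rewrite (iso_inj ei (Sigma_vert x sS) (Sigma_vert y tS) E) st.
have sS := fsubsetP KS _ sK; rewrite (vert_eq (y := y) sS) ?mem_fim ?mem_c0 //.
apply: parabolicS xy; apply/fsubsetP => t; rewrite !inE => /andP[tK ->]; rewrite andbT.
by apply: contraNneq tK => ->.
Qed.

Lemma chart_eq Sigma1 e x y : typed_chart Sigma1 e -> fim e (c0 x) = fim e (c0 y) -> x = y.
Proof.
move=> te E; have : parabolic (S `\` S)%fset (x^-1 * y).
  by apply/(chart_sub x y te (fsubset_refl S)) => s sS; rewrite -E; apply/mem_fim/mem_c0.
by rewrite fsetDv => /parabolic0 /mulg1_eq; rewrite invgK.
Qed.

(** Two typed charts of an apartment differ by a left translation: if they agree at a chamber, they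
    agree at its [s]-neighbour, the only other chamber of the apartment with the same vertices of
    types other than [s]. *)
Lemma chart_translate Sigma1 e e' x x' y y' : typed_chart Sigma1 e -> typed_chart Sigma1 e' ->
  fim e (c0 x) = fim e' (c0 x') -> fim e (c0 y) = fim e' (c0 y') -> x^-1 * y = x'^-1 * y'.
Proof.
move=> te te' xx' yy'; have [A1 ei ety] := te; have [_ ei' ety'] := te'.
have [es _ _] := (simplicial_isoP _ _ _).1 ei.
suff H w : fim e (c0 (x * w)) = fim e' (c0 (x' * w)).
  have := H (x^-1 * y); rewrite mulVKg yy' => /(chart_eq te') ->.
  by rewrite mulKg.
elim/(gen_ind cox): w => [|w s IH sS]; first by rewrite !mulg1.
rewrite !mulgA; have [z' E]
  := chamber_chart A1 ei' (chamber_c0 (x * w * s) A1 ei) (es _ (Sigma_c0 _)).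
suff : x' * w * s = z' by rewrite E => ->.
have : parabolic (S `\` (S `\ s))%fset ((x' * w)^-1 * z').
  apply/(chart_sub (x' * w) z' te' (fsubD1set _ _)) => t; rewrite !inE => /andP[/eqP ts tS].
  have : e' (vert (x' * w) t) \in fim e (c0 (x * w)) by rewrite IH; apply/mem_fim/mem_c0.
  move=> /fimP[_ /c0P[t' tS' ->] Et]; have tt' : t = t'.
    by rewrite -(ety' (x' * w) t tS) Et ety.
  by rewrite Et -tt' -E -(vert_adj (x * w) tS sS ts); apply/mem_fim/mem_c0.
rewrite fsetDK ?fsub1set // => /(parabolic_sing cox sS)[] zE; rewrite -(mulVKg (x' * w) z') zE //.
exfalso; apply: (gen_neq1 cox sS); apply: (@mulgI _ (x * w)); rewrite mulg1.
apply: (chart_eq te).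
by rewrite IH E -(mulVKg (x' * w) z') zE mulg1.
Qed.

Lemma chart_simplex Sigma1 e A : typed_chart Sigma1 e ->
  Sigma1 A <-> exists x, (A `<=` fim e (c0 x))%fset.
Proof.
move=> [A1 ei _]; split=> [|[x]]; first exact: iso_c0.
have [es _ _] := (simplicial_isoP _ _ _).1 ei; have [_ Sd] := AA_complex A1.
by apply/Sd/es/Sigma_c0.
Qed.

Lemma wdist_rel_fun C D w w' : wdist_rel C D w -> wdist_rel C D w' -> w = w'.
Proof.
move=> [Sigma1 [e [x [y [te Cx Dy ->]]]]] [Sigma2 [e' [x' [y' [te' Cx' Dy' ->]]]]].
have [A1 _ _] := te; have [A2 _ _] := te'.
have [|||| g [gi gC gD]] := @AA_iso Sigma1 Sigma2 C D A1 A2.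
- by apply/(chart_simplex _ te); exists x; rewrite Cx.
- by apply/(chart_simplex _ te); exists y; rewrite Dy.
- by apply/(chart_simplex _ te'); exists x'; rewrite Cx'.
- by apply/(chart_simplex _ te'); exists y'; rewrite Dy'.
have tge : typed_chart Sigma2 (g \o e).
  by apply: (chart_transport (x0 := x) te) => //; rewrite -Cx.
apply: (chart_translate tge te').
  by rewrite -Cx' (fim_comp e g) -Cx fim_id.
by rewrite -Dy' (fim_comp e g) -Dy fim_id.
Qed.

Definition wdist C D : W := xget 1 [set w | wdist_rel C D w]%classic.

Lemma wdist_chart Sigma1 e x y : typed_chart Sigma1 e ->
  wdist (fim e (c0 x)) (fim e (c0 y)) = x^-1 * y.
Proof.
move=> te; have H : wdist_rel (fim e (c0 x)) (fim e (c0 y)) (x^-1 * y) by exists Sigma1, e, x, y.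
by apply: xget_unique => // w /wdist_rel_fun; apply.
Qed.

Lemma chart_chamber Sigma1 e x : typed_chart Sigma1 e -> chamber Delta (fim e (c0 x)).
Proof. by move=> [A1 ei _]; apply: (chamber_c0 _ A1). Qed.

Lemma chart_isometric Sigma1 e : typed_chart Sigma1 e ->
  isometric (chamber Delta) wdist (fun x => fim e (c0 x)).
Proof. by move=> te; split=> [x|x y]; [exact: chart_chamber te|exact: wdist_chart te]. Qed.

Lemma common_chart C D : chamber Delta C -> chamber Delta D ->
  exists Sigma1 e x y, [/\ typed_chart Sigma1 e, C = fim e (c0 x) & D = fim e (c0 y)].
Proof.
move=> cC cD; have [_ /(_ _ _ cC.1 cD.1)[Sigma1 A1 [SC SD]] _] := ap.
have [e te] := chart_ex A1; have [_ ei _] := te.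
have [x Cx] := chamber_chart A1 ei cC SC; have [y Dy] := chamber_chart A1 ei cD SD.
by exists Sigma1, e, x, y.
Qed.

Definition vtypes A : {fset W} := [fset vtype v | v in A]%fset.

Lemma wdist_face C D A : chamber Delta C -> chamber Delta D -> (A `<=` C)%fset ->
  (A `<=` D)%fset <-> parabolic (S `\` vtypes A)%fset (wdist C D).
Proof.
move=> cC cD; have [Sigma1 [e [x [y [te -> ->]]]]] := common_chart cC cD.
rewrite (wdist_chart x y te) => /fsubsetP Ax; have [_ _ ety] := te.
have AS : (vtypes A `<=` S)%fset.
  by apply/fsubsetP => _ /imfsetP[v /= /Ax /fimP[_ /c0P[s sS ->] ->] ->]; rewrite ety.
split=> [/fsubsetP Ay|xy].
  apply/(chart_sub x y te AS) => s sA; have sS := fsubsetP AS _ sA.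
  have /imfsetP[v /= vA vs] := sA; have /fimP[_ /c0P[t tS ->] E] := Ax _ vA.
  by move: vs vA; rewrite E ety // => -> /Ay.
apply/fsubsetP => v vA; have /fimP[_ /c0P[t tS ->] E] := Ax _ vA.
rewrite E; apply: ((chart_sub x y te AS).2 xy); apply/imfsetP; exists v => //=.
by rewrite E ety.
Qed.

Lemma vtypes_chamber C : chamber Delta C -> vtypes C = S.
Proof.
move=> /vtype_chamber[H _ K]; apply/fsetP => s;
  apply/imfsetP/idP => [[v /= /H vS ->] //|/K[v vC <-]].
by exists v.
Qed.

Lemma wdist_eq1 C D : chamber Delta C -> chamber Delta D -> wdist C D = 1 <-> C = D.
Proof.
move=> cC cD; have H := wdist_face cC cD (fsubset_refl C).
rewrite vtypes_chamber // fsetDv in H; split=> [E|CD].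
  by apply/esym; apply: cC.2; [exact: cD.1|apply/H; rewrite E; exact: parabolic1].
by apply/parabolic0/H; rewrite CD.
Qed.

Lemma wdist_inv C D : chamber Delta C -> chamber Delta D -> wdist D C = (wdist C D)^-1.
Proof.
move=> cC cD; have [Sigma1 [e [x [y [te -> ->]]]]] := common_chart cC cD.
by rewrite !(wdist_chart _ _ te) invgM invgK.
Qed.

Definition face_of_type C s : {fset V} := [fset v in C | vtype v != s]%fset.

Lemma face_of_type_sub C s : (face_of_type C s `<=` C)%fset.
Proof. by apply/fsubsetP => v; rewrite !inE => /andP[]. Qed.

Lemma vtypes_face C s : chamber Delta C -> s \in S ->
  (S `\` vtypes (face_of_type C s) = [fset s])%fset.
Proof.
move=> cC sS; have [CS Cinj Csurj] := vtype_chamber cC.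
apply/fsetP => t; rewrite !inE; apply/andP/eqP => [[nt tS]|->].
  apply: contrapT => ts; move/negP: nt; apply; have [v vC vt] := Csurj _ tS.
  by apply/imfsetP; exists v => //=; rewrite !inE vC vt; apply/eqP.
by split => //; apply/negP => /imfsetP[v /=]; rewrite !inE => /andP[_ /eqP vs] /esym.
Qed.

Lemma wdist_gen C D s : chamber Delta C -> chamber Delta D -> s \in S ->
  (face_of_type C s `<=` D)%fset <-> wdist C D = 1 \/ wdist C D = s.
Proof.
move=> cC cD sS; rewrite (wdist_face cC cD (face_of_type_sub C s)) vtypes_face //.
split=> [|[->|->]]; first exact: (parabolic_sing cox sS).
  exact: parabolic1.
by apply: parabolic_gen; rewrite inE.
Qed.

(** An isomorphism fixing the shared panel [P] and [D] carries [C] to a chamber [E] of an apartment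
    through [C'] and [D]. [E] has the same distance to [D] as [C], and shares [P] with [C'], so it
    is [C'] or its [s]-neighbour there. *)
Lemma wdist_step C C' D s : chamber Delta C -> chamber Delta C' -> chamber Delta D -> s \in S ->
  wdist C C' = s -> wdist C' D = wdist C D \/ wdist C' D = s * wdist C D.
Proof.
move=> cC cC' cD sS CC'; set P := face_of_type C s.
have PC' : (P `<=` C')%fset by apply/wdist_gen => //; right.
have [Sigma1 [e [x [y [te Cx Dy]]]]] := common_chart cC cD.
have [Sigma2 [e' [x' [y' [te' Cx' Dy']]]]] := common_chart cC' cD.
have [A1 _ _] := te; have [A2 ei' _] := te'.
have [|||| g [gi gP gD]] := @AA_iso Sigma1 Sigma2 P D A1 A2.
- by apply/(chart_simplex _ te); exists x; rewrite -Cx face_of_type_sub.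
- by apply/(chart_simplex _ te); exists y; rewrite Dy.
- by apply/(chart_simplex _ te'); exists x'; rewrite -Cx'.
- by apply/(chart_simplex _ te'); exists y'; rewrite Dy'.
have tge : typed_chart Sigma2 (g \o e).
  by apply: (chart_transport (x0 := y) te) => //; rewrite -Dy.
have S2C' : Sigma2 C' by apply/(chart_simplex _ te'); exists x'; rewrite -Cx'.
have [_ gei _] := tge; have [z Cz] := chamber_chart A2 gei cC' S2C'.
have Dge : D = fim (g \o e) (c0 y) by rewrite (fim_comp e g) -Dy fim_id.
have cx := chart_chamber x tge; set E := fim _ _ in cx.
have PE : (P `<=` E)%fset by
  rewrite /E (fim_comp e g) -Cx -(fim_id gP); apply/fimS/face_of_type_sub.
have EC' : wdist E C' = 1 \/ wdist E C' = s.
  apply: (parabolic_sing cox sS); rewrite -(vtypes_face cC sS).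
  exact/(wdist_face cx cC').
have -> : wdist C D = x^-1 * y by rewrite Cx Dy (wdist_chart _ _ te).
have -> : wdist C' D = z^-1 * y by rewrite Cz Dge (wdist_chart _ _ tge).
move: EC'; rewrite Cz /E (wdist_chart _ _ tge) => xz.
have -> : z^-1 * y = (x^-1 * z)^-1 * (x^-1 * y) by rewrite invgM invgK -mulgA mulVKg.
by case: xz => ->; [left; rewrite invg1 mul1g|right; rewrite (gen_inv cox sS)].
Qed.

Lemma wdist_ex C D s : chamber Delta C -> chamber Delta D -> s \in S ->
  exists C', [/\ chamber Delta C', wdist C C' = s & wdist C' D = s * wdist C D].
Proof.
move=> cC cD sS; have [Sigma1 [e [x [y [te -> ->]]]]] := common_chart cC cD.
exists (fim e (c0 (x * s))); split; first exact: chart_chamber te.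
  by rewrite (wdist_chart _ _ te) mulKg.
by rewrite !(wdist_chart _ _ te) invgM (gen_inv cox sS) mulgA.
Qed.

Lemma face_of_typeE C s v : chamber Delta C -> v \in C -> vtype v = s ->
  face_of_type C s = (C `\ v)%fset.
Proof.
move=> cC vC vs; have [_ Cinj _] := vtype_chamber cC; apply/fsetP => u; rewrite !inE andbC.
have [uC|] := boolP (u \in C); last by rewrite !andbF.
rewrite !andbT; congr (~~ _); apply/eqP/eqP => [us|-> //].
by apply: Cinj; rewrite ?us.
Qed.

Lemma panel_face C s : chamber Delta C -> s \in S -> panel Delta (face_of_type C s).
Proof.
move=> cC sS; have [_ _ /(_ s sS)[v vC vs]] := vtype_chamber cC.
exists C; split => //; first exact: face_of_type_sub.
by rewrite (face_of_typeE cC vC vs) [in LHS](cardfsD1 v C) vC.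
Qed.

Lemma wdist_thick C C1 s : thick Delta -> chamber Delta C -> s \in S ->
  exists C', [/\ chamber Delta C', wdist C C' = s & C' <> C1].
Proof.
move=> th cC sS.
have [D1 [D2 [D3 [[c1 c2 c3] [[P1 P2 P3] [n12 n13 n23]]]]]] := th _ (panel_face cC sS).
suff [C' [cC' PC' CC' C'1]] : exists C', [/\ chamber Delta C', (face_of_type C s `<=` C')%fset,
    C' <> C & C' <> C1].
  exists C'; split => //; have /(wdist_gen cC cC' sS)[/(wdist_eq1 cC cC') /esym //|//] := PC'.
have [|n1] := pselect (D1 <> C /\ D1 <> C1); first by case; exists D1.
have [|n2] := pselect (D2 <> C /\ D2 <> C1); first by case; exists D2.
have [|n3] := pselect (D3 <> C /\ D3 <> C1); first by case; exists D3.
have H D : ~ (D <> C /\ D <> C1) -> D = C \/ D = C1.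
  by move=> nD; apply: contrapT => /not_orP[? ?]; apply: nD.
case: (H _ n1) (H _ n2) (H _ n3) n12 n13 n23 => -> [] -> [] -> //.
Qed.

Lemma wdist_wmetric : thick Delta -> thick_wmetric S (chamber Delta) wdist.
Proof.
move=> th; split.
- exact: wdist_eq1.
- exact: wdist_inv.
- exact: wdist_step.
- exact: wdist_ex.
- by move=> C C1 s cC sS; exact: wdist_thick.
Qed.

(** [panel] makes [P] one vertex short of some chamber [E]. Chambers have equal cardinality, so [P]
    is also [C] without one vertex, and the type of that vertex is the generator. *)
Lemma adjacent_wdist C D : adjacent Delta C D <->
  [/\ chamber Delta C, chamber Delta D & exists2 s, s \in S & wdist C D = s].
Proof.
split=> [[cC cD CD [P [[E [cE PE sE]] PC PD]]]|[cC cD [s sS CDs]]].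
  split => //; have [_ _ Dcard _] := cc.
  have := Dcard _ _ cE cC; rewrite sE => sC.
  have [v vC vP] : exists2 v, v \in C & v \notin P.
    apply: contrapT => no; have /fsubset_leq_card : (C `<=` P)%fset.
      by apply/fsubsetP => v vC; apply: contrapT => /negP vP; apply: no; exists v.
    by rewrite -sC ltnn.
  have [CS _ _] := vtype_chamber cC; exists (vtype v); first exact: CS.
  have : (face_of_type C (vtype v) `<=` D)%fset.
    rewrite (face_of_typeE cC vC erefl); apply: fsubset_trans PD.
    suff -> : P = (C `\ v)%fset by [].
    apply/eqP; rewrite eqEfcard fsubsetD1 PC vP /=.
    by move: sC; rewrite [in X in _ = X](cardfsD1 v C) vC => -[->].
  by move/(wdist_gen cC cD (CS _ vC)) => [/(wdist_eq1 cC cD)|].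
split => //; first by move=> /(wdist_eq1 cC cD); rewrite CDs; apply: gen_neq1 sS.
exists (face_of_type C s); split; [exact: panel_face|exact: face_of_type_sub|].
by apply/wdist_gen => //; right.
Qed.

End Building.

(** * Apartments as isometric images of the Coxeter group *)

Section Apartments.
Variables (V : choiceType) (Delta : set {fset V}) (W : groupType) (S : {fset W}).
Implicit Types (A B C D E : {fset V}) (J : {fset W}) (b c : W -> {fset V}) (ty : V -> W).

(** The type of the residue of [A]: in an apartment containing [A], the chambers through [A] form a
    coset of the parabolic subgroup of this type. *)
Definition cotype ty A : {fset W} := (S `\` [fset ty v | v in A])%fset.

Record building_metric (d : {fset V} -> {fset V} -> W) ty : Prop := BuildingMetric {
  bm_metric : thick_wmetric S (chamber Delta) d;
  bm_type : forall C, chamber Delta C ->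
    [/\ forall v, v \in C -> ty v \in S,
        forall u v, u \in C -> v \in C -> ty u = ty v -> u = v &
        forall s, s \in S -> exists2 v, v \in C & ty v = s];
  bm_face : forall C D A, chamber Delta C -> chamber Delta D -> (A `<=` C)%fset ->
    (A `<=` D)%fset <-> parabolic (cotype ty A) (d C D);
  bm_adj : forall C D, adjacent Delta C D <->
    [/\ chamber Delta C, chamber Delta D & exists2 s, s \in S & d C D = s];
  bm_chart : forall C D, chamber Delta C -> chamber Delta D ->
    exists c x y, [/\ isometric (chamber Delta) d c, C = c x & D = c y] }.

Definition carrier c : set {fset V} := [set A | exists x, (A `<=` c x)%fset]%classic.

Hypotheses (cox : coxeter_system S) (cc : chamber_complex Delta).
Variables (d : {fset V} -> {fset V} -> W) (ty : V -> W).
Hypothesis bm : building_metric d ty.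

Local Notation l := (len S).
Local Notation isom := (isometric (chamber Delta) d).
Local Notation cot := (cotype ty).

Let wm := bm_metric bm.

Lemma cotypeS A : (cot A `<=` S)%fset.
Proof. exact: fsubsetDl. Qed.

Lemma mem_cotype C A v : chamber Delta C -> (A `<=` C)%fset -> v \in C ->
  (ty v \in cot A) = (v \notin A).
Proof.
move=> cC AC vC; have [CS Cinj _] := bm_type bm cC; rewrite inE CS // andbT; congr (~~ _).
apply/imfsetP/idP => [[u /= uA vu]|vA]; last by exists v.
by rewrite (Cinj v u vC (fsubsetP AC _ uA) vu).
Qed.

Lemma isom_face c A x y : isom c -> (A `<=` c x)%fset ->
  (A `<=` c y)%fset <-> parabolic (cot A) (x^-1 * y).
Proof. by move=> [cc' dc] Ax; rewrite -dc; apply: (bm_face bm). Qed.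

Lemma carrier_complex c : isom c -> subcomplex (carrier c) Delta.
Proof.
move=> [ch _]; split; first split.
- by exists 1; exact: fsub0set.
- by move=> A B [x Ax] BA; exists x; apply: fsubset_trans Ax.
- move=> A [x Ax]; have [[_ Dd] _ _ _] := cc; exact: Dd (ch x).1 Ax.
Qed.

(** A simplex corresponds to the coset of positions whose chambers contain it; conversely [x] and
    [J] give the face of [c x] with the vertices of types outside [J]. *)
Lemma carrier_coxeter c : isom c -> coxeter_complex (carrier c).
Proof.
move=> ic; have [ch _] := ic; exists W, S; split => //.
pose phi A : set W := [set x | (A `<=` c x)%fset]%classic.
have phiE A x : (A `<=` c x)%fset -> phi A = coset x (cot A).
  move=> Ax; apply/seteqP; split=> y.
    by move=> /(isom_face _ ic Ax) xy; apply/cosetE.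
  by move=> /cosetE xy; apply/(isom_face _ ic Ax).
have phi_le A B : carrier c A -> carrier c B -> (A `<=` B)%fset <-> (phi B `<=` phi A)%classic.
  move=> [x Ax] [y By]; split=> [AB z Bz|]; first exact: fsubset_trans AB Bz.
  move=> sub; have {x Ax} Ay := sub y By; move: sub; rewrite (phiE _ _ Ay) (phiE _ _ By).
  move=> /(coset_sub cox _ _ (cotypeS _) (cotypeS _))[/fsubsetP BA _]; apply/fsubsetP => v vA.
  have vy := fsubsetP Ay _ vA; apply: contraT; rewrite -(mem_cotype (ch y) By vy) => /BA.
  by rewrite (mem_cotype (ch y) Ay vy) vA.
exists phi => //; split.
- by move=> A [x Ax]; exists x, (cot A); [exact: cotypeS|exact: phiE].
- move=> A B; rewrite !inE => cA cB E; apply/eqP; rewrite eqEfsubset; apply/andP.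
  by split; apply/phi_le => //; rewrite E.
- move=> _ [x [J JS ->]]; have [CS Cinj Csurj] := bm_type bm (ch x).
  pose A := [fset v in c x | ty v \notin J]%fset.
  have Ax : (A `<=` c x)%fset by apply/fsubsetP => v; rewrite !inE => /andP[].
  exists A; first by exists x.
  rewrite (phiE _ _ Ax); congr coset; apply/fsetP => s; apply/idP/idP => [sA|sJ].
    have [v vx vs] := Csurj s (fsubsetP (cotypeS A) _ sA).
    by move: sA; rewrite -vs (mem_cotype (ch x) Ax vx) !inE vx negbK.
  have [v vx vs] := Csurj s (fsubsetP JS _ sJ).
  by rewrite -vs (mem_cotype (ch x) Ax vx) !inE vx vs sJ.
Qed.

Lemma residue_dist C C' D J : chamber Delta C -> chamber Delta C' -> chamber Delta D ->
  (J `<=` S)%fset -> parabolic J (d C C') ->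
  exists2 p, parabolic J p & d C' D = p * d C D.
Proof.
move=> cC cC' cD /fsubsetP JS [u uJ]; rewrite -/(prodw u).
elim: u C cC uJ => [|s u IH] C cC uJ.
  rewrite prodw_nil => /(wm_eq wm cC cC') <-; exists 1; rewrite ?mul1g //; exact: parabolic1.
have sJ := uJ s (mem_head _ _); have sS := JS _ sJ; rewrite prodw_cons => E.
have [C1 [c1 CC1 C1C']] := wm_ex wm cC cC' sS.
have [||p Jp Ep] := IH C1 c1; first by move=> t tu; apply: uJ; rewrite inE tu orbT.
  by rewrite C1C' E (mul_genK cox _ sS).
rewrite Ep; have [->|->] := wm_step wm cC c1 cD sS CC1; first by exists p.
by exists (p * s); rewrite ?mulgA //; apply: parabolicM => //; exact: parabolic_gen.
Qed.

(** * Isomorphisms between the images of two isometries *)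

Lemma isom_translate c z : isom c -> isom (fun x => c (z * x)).
Proof. by move=> [ch dc]; split=> // x y; rewrite dc invgM -mulgA mulKg. Qed.

Lemma carrier_translate c z : carrier (fun x => c (z * x)) = carrier c.
Proof.
apply/seteqP; split=> A [x Ax]; first by exists (z * x).
by exists (z^-1 * x); rewrite mulVKg.
Qed.

(** Matches the vertices of [b z] and [c z] of equal type, for all [z] at once; vertices outside the
    image of [b] stay put. *)
Definition transfer b c (v : V) : V :=
  xget v [set u | ty u = ty v /\ exists z, v \in b z /\ u \in c z]%classic.

(** Independence of [z]: whether positions [z] and [z'] share their vertex of a given type depends
    only on [z^-1 * z'], for [b] and [c] alike. *)
Lemma transferP b c z v : isom b -> isom c -> v \in b z ->
  transfer b c v \in c z /\ ty (transfer b c v) = ty v.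
Proof.
move=> ib ic vz; have [chb _] := ib; have [chc _] := ic.
have [bS _ _] := bm_type bm (chb z); have [_ cinj csurj] := bm_type bm (chc z).
have [u uz uv] := csurj _ (bS _ vz).
suff -> : transfer b c v = u by [].
apply: xget_unique; first by split => //; exists z.
move=> u' [u'v [z' [vz' u'z']]]; apply: cinj; rewrite ?uv //.
have cot1 w w' : ty w = ty w' -> cot [fset w]%fset = cot [fset w']%fset.
  move=> E; congr (_ `\` _)%fset; apply/fsetP => s.
  by apply/imfsetP/imfsetP => -[a /[!inE] /eqP -> ->]; eexists; rewrite ?inE //.
rewrite -fsub1set; apply/(@isom_face c [fset u']%fset z' z ic); first by rewrite fsub1set.
rewrite (cot1 _ _ u'v); apply/(@isom_face b [fset v]%fset z' z ib); rewrite fsub1set //.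
Qed.

Lemma transferK b c z v : isom b -> isom c -> v \in b z ->
  transfer c b (transfer b c v) = v.
Proof.
move=> ib ic vz; have [uz uv] := transferP ib ic vz.
have [v'z v'u] := transferP ic ib uz; have [_ binj _] := bm_type bm (ib.1 z).
by apply: binj => //; rewrite v'u.
Qed.

Lemma fim_transferK b c A : isom b -> isom c -> carrier b A ->
  fim (transfer c b) (fim (transfer b c) A) = A.
Proof.
move=> ib ic [z /fsubsetP Az]; apply/fsetP => v; apply/fimP/idP => [[_ /fimP[u uA ->] ->]|vA].
  by rewrite (transferK ib ic (Az _ uA)).
by exists (transfer b c v); rewrite ?(transferK ib ic (Az _ vA)) ?mem_fim.
Qed.

Lemma carrier_transfer b c A : isom b -> isom c -> carrier b A -> carrier c (fim (transfer b c) A).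
Proof.
move=> ib ic [z /fsubsetP Az]; exists z; apply/fsubsetP => _ /fimP[v vA ->].
by have [] := transferP ib ic (Az _ vA).
Qed.

Lemma transfer_iso b c : isom b -> isom c -> simplicial_iso (carrier b) (carrier c) (transfer b c).
Proof.
move=> ib ic; apply/simplicial_isoP; split=> [A|A B cA cB E|B cB].
- exact: carrier_transfer.
- by rewrite -(fim_transferK ib ic cA) E fim_transferK.
- by exists (fim (transfer c b) B); rewrite ?fim_transferK //; exact: carrier_transfer.
Qed.

Lemma carrier_apartments :
  apartment_system Delta [set Sigma | exists2 c, isom c & Sigma = carrier c]%classic.
Proof.
split=> [_ [c ic ->]|A B DA DB|_ _ A B [b ib ->] [c ic ->] [x Ax] [y By] [x' Ax'] [y' By']].
- by split; [exact: carrier_complex|exact: carrier_coxeter].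
- have [_ Df _ _] := cc; have [C cC AC] := chamber_above Df DA.
  have [D cD BD] := chamber_above Df DB.
  have [c [x [y [ic Cx Dy]]]] := bm_chart bm cC cD.
  exists (carrier c); first by exists c.
  by split; [exists x; rewrite -Cx|exists y; rewrite -Dy].
have [[chb db] [chc dc]] := (ib, ic).
have [p Ap Ep] : exists2 p, parabolic (cot A) p & d (c x') (b y) = p * d (b x) (b y).
  by apply: residue_dist (cotypeS A) _ => //; apply/(bm_face bm).
have [q Bq Eq] : exists2 q, parabolic (cot B) q & d (c y') (c x') = q * d (b y) (c x').
  by apply: residue_dist (cotypeS B) _ => //; apply/(bm_face bm).
have E : x'^-1 * y' = p * (x^-1 * y) * q^-1.
  rewrite -dc (wm_inv wm (chc y') (chc x')) Eq invgM -(wm_inv wm (chb y) (chc x')) Ep db.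
  done.
(* Translating [c] by [z] puts [A] at position [x] and [B] at position [y], as in [b]: indeed
   [z * x = x' * p] and [z * y = y' * q]. The transfer then fixes both simplices. *)
pose z := x' * p * x^-1.
have ib' := isom_translate z ic; rewrite -(carrier_translate c z).
have Ax2 : (A `<=` c (z * x))%fset.
  by apply/(isom_face _ ic Ax'); rewrite /z mulgVK mulKg.
have By2 : (B `<=` c (z * y))%fset.
  have zy : z * y = y' * q.
    have := congr1 (fun t => x' * t * q) E; rewrite mulVKg => ->.
    by rewrite /z !mulgA mulgVK.
  by apply/(isom_face _ ic By'); rewrite zy mulKg.
exists (transfer b (fun x => c (z * x))); first exact: transfer_iso.
have fix_ v w : v \in b w -> v \in c (z * w) -> transfer b (fun x => c (z * x)) v = v.
  move=> vb vc; have [uc uv] := transferP ib ib' vb.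
  by have [_ cinj _] := bm_type bm (chc (z * w)); apply: cinj.
move=> v; rewrite in_fsetU => /orP[vA|vB].
  by apply: (fix_ v x); [exact: (fsubsetP Ax)|exact: (fsubsetP Ax2)].
by apply: (fix_ v y); [exact: (fsubsetP By)|exact: (fsubsetP By2)].
Qed.

(** * Galleries, convexity and gates of residues *)

Lemma gallery_len C D g : chamber Delta D -> gallery Delta C D g -> l (d C D) <= size g.
Proof.
move=> cD []; elim: g C => [|E g IH] C cC /=.
  by move=> _ CD; rewrite (_ : d C D = 1) ?len1 //; apply/(wm_eq wm).
move=> /andP[/asboolP /(bm_adj bm)[_ cE [s sS CE]] pg lg].
have := IH E cE pg lg; have [->|->] := wm_step wm cC cE cD sS CE; first exact: leqW.
by move=> H; rewrite -(mul_genK cox (d C D) sS); exact: leq_trans (len_gen_mul cox _ sS) _.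
Qed.

Fixpoint chart_gallery c w (u : seq W) : seq {fset V} :=
  if u is s :: u' then c (w * s) :: chart_gallery c (w * s) u' else [::].

Lemma chart_galleryP c w u : isom c -> {subset u <= S} ->
  gallery Delta (c w) (c (w * prodw u)) (chart_gallery c w u).
Proof.
move=> [ch dc]; elim: u w => [|s u IH] w uS.
  by split => //=; rewrite prodw_nil mulg1.
have sS := uS s (mem_head _ _).
have [|_ pg lg] := IH (w * s); first by move=> t tu; apply: uS; rewrite inE tu orbT.
split => //=; last by rewrite lg prodw_cons mulgA.
rewrite pg andbT; apply/asboolP/(bm_adj bm); split => //.
by exists s => //; rewrite dc mulKg.
Qed.

Lemma size_chart_gallery c w u : size (chart_gallery c w u) = size u.
Proof. by elim: u w => //= s u IH w; rewrite IH. Qed.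

Lemma dist_isom c x y : isom c -> dist Delta (c x) (c y) = l (x^-1 * y).
Proof.
move=> ic; have [ch dc] := ic; have [u [uS ux su]] := len_word (parabolicT cox (x^-1 * y)).
have gal : gallery Delta (c x) (c y) (chart_gallery c x u).
  by have := chart_galleryP x ic uS; rewrite ux mulVKg.
have low g : gallery Delta (c x) (c y) g -> l (x^-1 * y) <= size g.
  by move=> /(gallery_len (ch y)); rewrite dc.
apply: xget_unique => [|n [[g gg <-] gmin]].
  by split => //; exists (chart_gallery c x u); rewrite ?size_chart_gallery.
apply/eqP; rewrite eqn_leq low // andbT -su -(size_chart_gallery c x u).
exact: gmin.
Qed.

(** A shortest word of [w^-1 * y] starting with [s] yields a minimal gallery from [c w] to [c y]
    through [c (w * s)]. *)
Lemma convex_wconvex c (kappa : set {fset V}) : isom c -> convex Delta kappa ->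
  wconvex S [set x | kappa (c x)]%classic.
Proof.
move=> ic kconv w y s /= kw ky sS lt; have [ch _] := ic.
have [u [uS uw su]] := len_word (parabolicT cox (s * (w^-1 * y))).
have suS : {subset s :: u <= S} by move=> t; rewrite inE => /orP[/eqP ->|/uS].
have E : w * prodw (s :: u) = y by rewrite prodw_cons uw (mul_genK cox _ sS) mulVKg.
have := chart_galleryP w ic suS; rewrite E => gal.
apply: (kconv _ _ _ (ch w) (ch y) kw ky gal); last by rewrite !inE eqxx orbT.
rewrite size_chart_gallery (dist_isom _ _ ic) /= su; apply/eqP; rewrite eqn_leq lt.
by rewrite -{1}(mul_genK cox (w^-1 * y) sS) len_gen_mul.
Qed.

(** Gate property of residues. Along a shortest [J]-word from [D] to [E] the length grows at each
    step by [len_mul_min], so [wm_up] determines each distance from [C]. *)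
Lemma gate_dist C D E J : chamber Delta C -> chamber Delta D -> chamber Delta E ->
  (J `<=` S)%fset -> (forall z, parabolic J z -> l (d C D) <= l (d C D * z)) ->
  parabolic J (d D E) -> d C E = d C D * d D E.
Proof.
move=> cC cD cE JS min; move: {2}(len J _) (erefl (len J (d D E))) => n.
elim: n E cE => [|n IH] E cE lE JE.
  by have E1 := len_eq0 JE lE; rewrite E1 mulg1; move/(wm_eq wm cD cE): E1 => ->.
have [u [uJ uE su]] := len_word JE; move: su; rewrite lE.
elim/last_ind: u uJ uE => // u s _ uJ; rewrite -cats1 prodw_cat prodw_cons prodw_nil mulg1.
rewrite size_cat addn1 => uE [su].
have sJ : s \in J by apply: uJ; rewrite mem_rcons mem_head.
have sS := fsubsetP JS _ sJ.
have uJ' : {subset u <= J} by move=> t tu; apply: uJ; rewrite mem_rcons inE tu orbT.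
have [E' [cE' EE' E'D]] := wm_ex wm cE cD sS.
have DE' : d D E' = prodw u.
  by rewrite (wm_inv wm cE' cD) E'D (wm_inv wm cD cE) invgM invgK (gen_inv cox sS) -uE -mulgA
             (gen_sqr cox sS) mulg1.
have JE' : parabolic J (d D E') by rewrite DE'; exact: parabolic_word.
have lE' : len J (d D E') = n.
  apply/eqP; rewrite eqn_leq {1}DE' -{1}su len_leq //=.
  have [v [vJ vE' <-]] := len_word JE'; rewrite -ltnS -lE -uE -DE' -vE'.
  have -> : prodw v * s = prodw (rcons v s).
    by rewrite -cats1 prodw_cat prodw_cons prodw_nil mulg1.
  rewrite -(size_rcons v s); apply: len_leq => t; rewrite mem_rcons inE => /orP[/eqP ->//|/vJ//].
have CE' := IH E' cE' lE' JE'.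
have lCE : l (d C D * d D E) = l (d C D) + n.+1 by rewrite (len_mul_min cox JS JE min) lE.
have lCE' : l (d C E') = l (d C D) + n by rewrite CE' (len_mul_min cox JS JE' min) lE'.
have E'E : d E' E = s by rewrite (wm_inv wm cE cE') EE' (gen_inv cox sS).
have Eq : d C D * d D E = d C E' * s by rewrite CE' DE' -uE mulgA.
rewrite Eq (wm_inv wm cE cC) (wm_up cox wm cE' cE cC sS E'E).
  by rewrite invgM (gen_inv cox sS) -(wm_inv wm cE' cC).
rewrite (wm_inv wm cC cE') -{1}(gen_inv cox sS) -invgM !(lenV cox) -Eq lCE lCE'.
by rewrite addnS.
Qed.

Lemma min_coset w J : exists2 p, parabolic J p &
  forall z, parabolic J z -> l (w * p) <= l (w * p * z).
Proof.
pose P n := `[< exists2 p, parabolic J p & l (w * p) = n >].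
have exP : exists n, P n by exists (l (w * 1)); apply/asboolP; exists 1 => //; exact: parabolic1.
case: (ex_minnP exP) => n /asboolP[p Jp <-] min; exists p => // z Jz.
by apply: min; apply/asboolP; exists (p * z); [exact: parabolicM|rewrite mulgA].
Qed.

(* The common chamber is the one containing A that is nearest to b x0. *)
Lemma common_chamber b c x0 A x y : isom b -> isom c -> b x0 = c x0 ->
  (A `<=` b x)%fset -> (A `<=` c y)%fset ->
  exists x' y', b x' = c y' /\ (A `<=` b x')%fset.
Proof.
move=> ib ic E0 Ax Ay; have [[chb db] [chc dc]] := (ib, ic).
have [p Jp pmin] := min_coset (x0^-1 * x) (cot A).
have [q Jq qmin] := min_coset (x0^-1 * y) (cot A).
have Axp : (A `<=` b (x * p))%fset by apply/(isom_face _ ib Ax); rewrite mulKg.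
have Ayq : (A `<=` c (y * q))%fset by apply/(isom_face _ ic Ay); rewrite mulKg.
exists (x * p), (y * q); split => //; apply/esym/(wm_eq wm (chc _) (chb _)).
have JDE : parabolic (cot A) (d (c (y * q)) (b (x * p))) by apply/(bm_face bm).
have dD : d (c x0) (c (y * q)) = x0^-1 * y * q by rewrite dc mulgA.
have dE : d (c x0) (b (x * p)) = x0^-1 * x * p by rewrite -E0 db mulgA.
have := gate_dist (chc x0) (chc (y * q)) (chb (x * p)) (cotypeS A) _ JDE.
rewrite dD dE => /(_ qmin) E.
(* By [E] and additivity, the second chamber is farther from [c x0] than the first by the length of
   their distance; the minimality of [p] makes this length 0. *)
have := pmin _ (parabolicV cox (cotypeS A) JDE); rewrite {2}E mulgK E.
rewrite (len_mul_min cox (cotypeS A) JDE qmin) -{2}[l _]addn0 leq_add2l leqn0 => /eqP.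
exact: len_eq0.
Qed.

End Apartments.

(** * From the building to its metric, and the intersection of the apartments *)

Lemma apartment_metric (V : choiceType) (v0 : V) (Delta Sigma : set {fset V}) :
  building Delta -> thick Delta -> apartment Delta Sigma ->
  exists (W : groupType) (S : {fset W}) d ty c,
    [/\ coxeter_system S, building_metric Delta S d ty, isometric (chamber Delta) d c &
        Sigma = carrier c].
Proof.
move=> [cc _] th [AA ap AAS]; have [/(_ _ AAS)[[cS _] [W [S [cox [phi bphi le_phi]]]]] _ _] := ap.
have [vert lab] := coxeter_labelling cox v0 cS bphi le_phi.
exists W, S, (wdist Sigma AA S vert), (vtype Sigma AA S vert).
have [e te] := chart_ex cox cc ap AAS lab AAS.
exists (fun x => fim e (lchamber S vert x)); split=> //.
- split.
  + exact: wdist_wmetric.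
  + exact: vtype_chamber.
  + exact: wdist_face.
  + exact: adjacent_wdist.
  + move=> C D cC cD; have [Sigma1 [e1 [x [y [te1 Cx Dy]]]]]
    := common_chart cox cc ap AAS lab cC cD.
    exists (fun x => fim e1 (lchamber S vert x)), x, y; split => //.
    exact: chart_isometric te1.
- exact: chart_isometric te.
- by apply/seteqP; split=> A /(chart_simplex ap lab A te).
Qed.

Theorem proposition2p1 (V : choiceType) (Delta : set {fset V})
    (building_Delta : building Delta) (thick_Delta : thick Delta)
    (Sigma : set {fset V}) (apartment_Sigma : apartment Delta Sigma)
    (kappa : set {fset V}) (kappa_sub_Sigma : (kappa `<=` Sigma)%classic)
    (kappa_chamber : chamber_subcomplex kappa Delta)
    (kappa_convex : convex Delta kappa) :
  exists2 Sigma' : set {fset V},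
    apartment Delta Sigma' & kappa = (Sigma `&` Sigma')%classic.
Proof.
have [[[k0 kdown] kDelta] kch] := kappa_chamber.
(* If [V] is empty, the empty simplex is the only one and [Sigma] itself serves. Otherwise [v0]
   supplies the junk value of the labelling. *)
have [[v0 _]|noV] := pselect (exists v : V, True); last first.
  have V0 (A : {fset V}) : A = fset0.
    by have [//|[v]] := fset_0Vmem A; case: noV; exists v.
  by exists Sigma => //; rewrite setIid; apply/seteqP; split=> // A _; rewrite (V0 A).
have [W [S [d [ty [c [cox bm ic eSigma]]]]]]
  := apartment_metric v0 building_Delta thick_Delta apartment_Sigma.
have [cc _] := building_Delta; have [_ [n Dn] _ _] := cc; have [chc _] := ic.
have kfin : finite_dimensional kappa by exists n => A /kDelta /Dn.
have kappa_face A : kappa A -> exists2 x, kappa (c x) & (A `<=` c x)%fset.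
  move=> kA; have [C cC AC] := chamber_above kfin kA.
  have := kappa_sub_Sigma _ cC.1; rewrite eSigma => -[x Cx].
  have E : c x = C by apply: (kch _ cC).2 => //; exact: (chc x).1.
  by exists x; rewrite E //; exact: cC.1.
(* A chamber of [kappa] above the empty simplex. *)
have [x0 kx0 _] := kappa_face _ k0.
have [b [ib bc bnew]] := convex_extension cox (bm_metric bm) ic (ex_intro _ x0 kx0)
  (convex_wconvex cox bm ic kappa_convex).
exists (carrier b).
  by exists [set Sigma' | exists2 c, isometric (chamber Delta) d c & Sigma' = carrier c]%classic;
    [exact: (carrier_apartments cox cc bm)|exists b].
apply/seteqP; split=> [A kA|A [SA [x Ax]]].
  split; first exact: kappa_sub_Sigma.
  by have [x kx Ax] := kappa_face _ kA; exists x; rewrite bc.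
move: SA; rewrite eSigma => -[y Ay].
(* A common simplex lies in a common chamber, which belongs to [kappa] by the choice of [b]. *)
have [x' [y' [E Ax']]] := common_chamber cox bm ib ic (bc _ kx0) Ax Ay.
have kx' := bnew _ _ E; apply: (kdown (c x')) => //.
by rewrite -bc.
Qed.
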